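(* Let $T>0$ and $k>0$. The dynamic Preisach operator $\mathcal{F}_D:\mathrm{L}^2(0,T)\times Y\to\mathrm{H}^1(0,T)$ is order preserving: if $u_1,u_2\in\mathrm{L}^2(0,T)$ and $\xi_1,\xi_2\in Y$ satisfy $u_1\le u_2$ a.e. in $[0,T]$ and $\xi_1\le\xi_2$ a.e. in $\mathcal{T}$, then $[\mathcal{F}_D(u_1,\xi_1)](t)\le[\mathcal{F}_D(u_2,\xi_2)](t)$ for all $t\in[0,T]$. Moreover, it satisfies the following properties: (i) It is Lipschitz-continuous; more precisely, for all $u_1,u_2\in\mathrm{L}^2(0,T)$ and $\xi_1,\xi_2\in Y$, $$\|\mathcal{F}_D(u_1,\xi_1)-\mathcal{F}_D(u_2,\xi_2)\|_{C([0,T])}\le e^{T/2}\left(\|\xi_1-\xi_2\|_{\mathrm{L}^1_p(\mathcal{T})}+k\|u_1-u_2\|_{\mathrm{L}^2(0,T)}\int_{\mathcal{T}}p(\rho)\,d\rho\right).$$ (ii) It is bounded in the following sense: for all $v\in\mathrm{L}^2(0,T)$ and $\xi\in Y$, $$\|\mathcal{F}_D(v,\xi)\|_{C([0,T])}\le\int_{\mathcal{T}}p(\rho)\,d\rho .$$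
   Context: Notation: $x^+=\max\{x,0\}$, $x^-=\max\{-x,0\}$. Dynamic relay. For $\rho=(\rho_1,\rho_2)\in\mathbb{R}^2$ with $\rho_1<\rho_2$ set $g_\rho(s)=-k(s-\rho_1)^-+k(s-\rho_2)^+$. For $u\in\mathrm{L}^2(0,T)$ and $\xi\in[-1,1]$, $\eta_\rho(u,\xi)$ is the unique function $y\in\mathrm{H}^1(0,T)$ (identified with its continuous representative) with $-1\le y\le 1$ such that $y(0)=\xi$ and, for a.e. $t\in(0,T)$, $g_\rho(u(t))-\frac{dy}{dt}(t)\in\partial\chi_{[-1,1]}(y(t))$, where $\partial\chi_{[-1,1]}(x)$ equals $[0,\infty)$ if $x=1$, $(-\infty,0]$ if $x=-1$, $\{0\}$ if $|x|<1$, and $\emptyset$ if $|x|>1$. Preisach operator. Given $\rho_0>0$, $\mathcal{T}=\{\rho=(\rho_1,\rho_2)\in\mathbb{R}^2:-\rho_0\le\rho_1\le\rho_2\le\rho_0\}$ and $p\in\mathrm{L}^1(\mathcal{T})$ with $p>0$ is given (the diagonal $\rho_1=\rho_2$ has measure zero and is irrelevant). $\mathrm{L}^1_p(\mathcal{T})$ is the space of Lebesgue-measurable $\xi:\mathcal{T}\to\mathbb{R}$ with $\|\xi\|_{\mathrm{L}^1_p(\mathcal{T})}:=\int_{\mathcal{T}}|\xi(\rho)|p(\rho)\,d\rho<\infty$, and $Y=\{v\in\mathrm{L}^1_p(\mathcal{T}):|v(\rho)|\le1\text{ a.e. }\rho\in\mathcal{T}\}$. For $u\in\mathrm{L}^2(0,T)$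 and $\xi\in Y$, $$[\mathcal{F}_D(u,\xi)](t)=\int_{\mathcal{T}}[\eta_\rho(u,\xi(\rho))](t)\,p(\rho)\,d\rho .$$ *)

(* Defs.v *)
From HB Require Import structures.
From mathcomp Require Import all_boot all_order all_algebra.
From mathcomp Require Import all_classical all_reals all_analysis.

Set Implicit Arguments.
Unset Strict Implicit.
Unset Printing Implicit Defensive.

Import Order.TTheory GRing.Theory Num.Theory.
Import numFieldNormedType.Exports.

Local Open Scope classical_set_scope.
Local Open Scope ring_scope.

(* [lebesgue_measure] lives on the Borel sets. Measurability, integrals and
   "almost everywhere" are taken here with respect to its completion, so that
   measurable means Lebesgue measurable, both on R and on R * R. *)
Notation leb1 R := (@completed_lebesgue_measure R).

Section PlaneLebesgueMeasure.
Variable R : realType.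

Let borel_leb2 := ((@lebesgue_measure R) \x (@lebesgue_measure R))%E.

Definition plane := caratheodory_type (mu_ext borel_leb2).
HB.instance Definition _ := Measurable.on plane.

Definition leb2 : set plane -> \bar R :=
  @completed_measure_extension _ _ _ borel_leb2.
HB.instance Definition _ := Measure.on leb2.

End PlaneLebesgueMeasure.
Arguments leb2 : clear implicits.

Section FunctionSpaces.
Variable R : realType.
Implicit Types (T : R) (f y w phi : R -> R).

(* Elements of L^2(0,T) are represented by functions on R whose values outside
   ]0, T[ play no role: [f \_ D] is f on D and 0 elsewhere. *)
Definition L2 T : set (R -> R) :=
  [set f | f \_ `]0, T[ \in Lfun (leb1 R) 2%:E].

Definition L2norm T f : \bar R := 'N[leb1 R]_2%:E[EFin \o (f \_ `]0, T[)].

Definition Cnorm T f : \bar R :=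
  ereal_sup [set (`|f t|)%:E | t in `[0, T]].

Definition C1c T : set (R -> R) :=
  [set phi : R -> R | [/\ forall x, derivable phi x (1 : R),
                           continuous (derive1 phi)
                         & closure [set x | phi x != 0] `<=` `]0, T[ ]].

Definition weak_derivative T y w : Prop :=
  L2 T w /\
  forall phi, C1c T phi ->
    \int[leb1 R]_(t in `]0, T[) (y t * derive1 phi t) =
    - \int[leb1 R]_(t in `]0, T[) (w t * phi t).

(* The elements of H^1(0,T), each given by its representative that is
   continuous on [0, T]. *)
Definition H1 T : set (R -> R) :=
  [set y | [/\ {within `[0, T], continuous y},
               L2 T y
             & exists w, weak_derivative T y w]].

End FunctionSpaces.

Section Relay.
Variable R : realType.
Implicit Types (T k x s : R) (rho : R * R) (u : R -> R).

Definition pos_part x : R := Num.max x 0.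
Definition neg_part x : R := Num.max (- x) 0.

Definition g k rho s : R :=
  - (k * neg_part (s - rho.1)) + k * pos_part (s - rho.2).

(* Subdifferential of the indicator function of [-1, 1]. *)
Definition subdiff_chi x : set R :=
  if x == 1 then [set v | 0 <= v]
  else if x == -1 then [set v | v <= 0]
  else if `|x| < 1 then [set 0]
  else set0.

Definition relay_solution T k rho u x : set (R -> R) :=
  [set y | [/\ H1 T y,
               forall t, t \in `[0, T] -> -1 <= y t <= 1,
               y 0 = x
             & exists2 w, weak_derivative T y w &
                 {ae leb1 R, forall t, t \in `]0, T[ ->
                    subdiff_chi (y t) (g k rho (u t) - w t)}]].

(* Solutions are only determined on [0, T]; when there is none, as for
   |x| > 1, the value is the zero function. *)
Definition eta T k rho u x : R -> R :=
  xget (fun=> 0) (relay_solution T k rho u x).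

End Relay.

Section Preisach.
Variable R : realType.
Implicit Types (T k : R) (p xi : R * R -> R) (u : R -> R).

Definition triangle (rho0 : R) : set (R * R) :=
  [set rho | [&& - rho0 <= rho.1, rho.1 <= rho.2 & rho.2 <= rho0]].

Definition L1pnorm (rho0 : R) p xi : \bar R :=
  (\int[leb2 R]_(rho in triangle rho0) (`|xi rho| * p rho)%:E)%E.

Definition L1p (rho0 : R) p : set (R * R -> R) :=
  [set xi | measurable_fun (T := plane R) (triangle rho0) xi /\
            (L1pnorm rho0 p xi < +oo)%E].

Definition Y (rho0 : R) p : set (R * R -> R) :=
  [set xi | L1p rho0 p xi /\
            {ae leb2 R, forall rho, triangle rho0 rho -> `|xi rho| <= 1}].

Definition F_D T k (rho0 : R) p u xi (t : R) : R :=
  \int[leb2 R]_(rho in triangle rho0) (eta T k rho u (xi rho) t * p rho).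

End Preisach.

(* Main.v *)
(* Write f for g_rho(u). The comparison principle for f - y' in subdiff y is read
   off the last zero of the positive part of y1 - y2 before t; it gives
   |y1 - y2|(t) <= |x1 - x2| + int_0^t |f1 - f2|, hence uniqueness,
   monotonicity, the bounds, and Lipschitz (so measurable) dependence on rho and
   on the initial state. Existence comes from an explicit sup-min formula for
   c = y - F, F the primitive of f: c moves down only while y = 1 and up only
   while y = -1, which gives the inclusion wherever the absolutely continuous
   functions y and F are differentiable. Absolutely continuous functions and
   weak derivatives are linked by Radon-Nikodym for Lebesgue-Stieltjes measures
   (densities), by a direct proof of the product rule (integration by parts),
   and by the du Bois-Reymond argument. F_D inherits its modulus of continuity
   in time from the relays, so it has a square integrable density. *)
From HB Require Import structures.
Require Import Defs.
From mathcomp Require Import all_boot all_order all_algebra.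
From mathcomp Require Import all_classical all_reals all_analysis.
From mathcomp Require Import measurable_realfun.
From mathcomp Require Import lra ring.
Import Order.TTheory GRing.Theory Num.Theory.
Import numFieldNormedType.Exports.

Set Implicit Arguments.
Unset Strict Implicit.
Unset Printing Implicit Defensive.

Local Open Scope classical_set_scope.
Local Open Scope ring_scope.

(** * Borel and Lebesgue measurability *)

(** [eta] is a choice among solutions, so everything known about it comes from its being a solution
    and from comparison; this is why even its measurability in [rho] goes through Lipschitz
    estimates. The comparison bound is kept one-sided, with [Num.max (x1 - x2) 0] on the right: a
    vanishing forcing bound then gives order preservation, and exchanging the two solutions gives
    the Lipschitz estimate. The forcing bound is a function of time common to all [rho], so its
    primitive factors out of the integral against [p].

    Everything is carried out on the whole line: inputs and derivatives are extended by zero outside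
    []0, T[], while states and [F_D] are frozen outside the time interval. A density dominated
    pointwise by an extension by zero is then automatically supported in []0, T[]. Since measurable
    means Lebesgue measurable, results about Borel functions are reached through Borel
    representatives. *)

Section Completion.
Context {R : realType}.
Notation mu := (@lebesgue_measure R).
Notation lam := (leb1 R).
Notation LR := (caratheodory_type (@wlength R idfun)^*%mu).

Lemma borel_lebesgue_measurable (A : set R) :
  measurable (A : set R) -> measurable (A : set LR).
Proof. exact: sub_caratheodory. Qed.

Lemma leb1_borel (A : set R) : lam A = mu A.
Proof. by []. Qed.

Lemma ae_borel_leb1 (P : R -> Prop) :
  {ae mu, forall x, P x} -> {ae lam, forall x, P x}.
Proof.
move=> [A [mA A0 PA]]; exists A; split => //; exact: borel_lebesgue_measurable.
Qed.

Lemma measurable_fun_borel_lebesgue d' (T' : measurableType d') (D : set R) (f : R -> T') :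
  measurable_fun D f ->
  measurable (D : set R) ->
  measurable_fun (T := LR) D f.
Proof.
move=> mf mD _ B mB; apply: borel_lebesgue_measurable; exact: mf.
Qed.

(** The identity from the completed to the Borel sigma-algebra is measurable and pushes [lam]
    forward to [mu], so this is a change of variables. *)
Lemma ge0_integral_borel_leb1 (D : set R) (f : R -> \bar R) :
  measurable (D : set R) ->
  measurable_fun D f ->
  (forall x, D x -> 0 <= f x)%E ->
  (\int[lam]_(x in D) f x = \int[mu]_(x in D) f x)%E.
Proof.
move=> mD mf f0.
have mid : measurable_fun (T := LR) setT (idfun : LR -> measurableTypeR R).
  by move=> _ B mB; rewrite setTI; apply: borel_lebesgue_measurable.
have f0' : {in D, forall y, (0 <= f y)%E} by move=> x /set_mem; exact: f0.
rewrite -[LHS](ge0_integral_pushforward mid lam mD mf f0').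
apply: eq_measure_integral => A mA _; exact: leb1_borel.
Qed.

Lemma integral_borel_leb1 (D : set R) (f : R -> \bar R) :
  measurable (D : set R) ->
  measurable_fun D f ->
  (\int[lam]_(x in D) f x = \int[mu]_(x in D) f x)%E.
Proof.
move=> mD mf; rewrite integralE [RHS]integralE.
by congr (_ - _)%E; apply: ge0_integral_borel_leb1 => //;
  [exact: measurable_funepos|exact: measurable_funeneg].
Qed.

Lemma integrable_borel_leb1 (D : set R) (f : R -> \bar R) :
  measurable (D : set R) ->
  measurable_fun D f ->
  lam.-integrable D f <-> mu.-integrable D f.
Proof.
move=> mD mf; split => /integrableP[_ fi]; apply/integrableP; split => //.
- rewrite -ge0_integral_borel_leb1//; exact: measurableT_comp.
- exact: measurable_fun_borel_lebesgue.
- rewrite ge0_integral_borel_leb1//; exact: measurableT_comp.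
Qed.

(* A Borel null set [N] swallows, for all rational [q] at once, the difference
   between [f @^-1` `]q, +oo[] and a Borel subset of it. *)
Lemma borel_representative (f : R -> R) :
  measurable_fun (T := LR) setT f ->
  exists2 f' : R -> R, measurable_fun setT f' &
    {ae lam, forall x, f x = f' x}.
Proof.
move=> mf.
have /choice[N HN] (q : rat) : exists N : set R,
    [/\ measurable (N : set R), mu N = 0 &
     measurable (((f @^-1` `]ratr q, +oo[) `\` N) : set R)].
  have : measurable ((setT : set LR) `&` f @^-1` `]ratr q, +oo[).
    by apply: mf => //; exact: measurable_itv.
  rewrite setTI => mE.
  have : (completed_algebra_gen mu).-sigma.-measurable (f @^-1` `]ratr q, +oo[).
    by rewrite completed_caratheodory_measurable.
  (* A measurable set of the completion is a Borel set [B] united with a subset [M] of a Borel null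
     set [C]; removing [C] leaves the Borel set [B] minus [C]. *)
  rewrite g_sigma_completed_algebra_genE => -[B mB [M [C [mC C0 MC]]] BM].
  exists C; split => //.
  have -> : f @^-1` `]ratr q, +oo[ `\` C = B `\` C.
    rewrite -BM; apply/seteqP; split => x /= [H nC]; split => //.
      by case: H => // /MC.
    by left.
  exact: measurableD.
pose C := \bigcup_q N q.
have mC : measurable (C : set R).
  by apply: bigcupT_measurable_rat => q; case: (HN q).
have C0 : mu C = 0.
  apply: measure_negligible => //.
  have -> : C = \bigcup_n N (odflt 0%Q (unpickle n)).
    apply/seteqP; split => x [q _ Nx]; last by exists (odflt 0%Q (unpickle q)).
    by exists (pickle q); rewrite ?pickleK.
  apply: negligible_bigcup => n.
  by have [mN N0 _] := HN (odflt 0%Q (unpickle n)); exact/negligibleP.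
have NC q : N q `<=` C by move=> x Nx; exists q.
exists (fun x => if x \in C then 0 else f x); last first.
  exists C; split => //; first exact: borel_lebesgue_measurable.
  move=> x /= H; apply: contrapT => nC; apply: H.
  by rewrite ifF//; apply/negbTE; rewrite notin_setE.
rewrite (_ : (fun x => _) = patch (fun=> 0) (~` C) f); last first.
  apply/funext => x; rewrite /patch in_setC; by case: ifPn.
apply/(measurable_restrictT _ _).1; first exact: measurableC.
apply: (measurability (@RGenOInfty.G R)).
  exact: RGenOInfty.measurableE.
move=> _ [_ [a ->] <-].
(* Off [C], [f x] exceeds [a] iff it exceeds some rational [q > a], and each of these countably many
   superlevel sets is Borel after removal of [N q]. *)
rewrite (_ : _ `&` _ = (\bigcup_q
   (if a < ratr q then (f @^-1` `]ratr q, +oo[) `\` N q else set0)) `\` C); last first.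
  apply/seteqP; split => x.
    move=> [nC /=]; rewrite in_itv/= andbT => afx.
    have [q] := rat_in_itvoo afx; rewrite in_itv/= => /andP[aq qf].
    split => //; exists q => //=; rewrite aq; split; first by rewrite /= in_itv/= qf.
    by move=> /NC.
  move=> [[q _ /=]]; case: ifPn => // aq [/=].
  rewrite in_itv/= andbT => qf _ nC; split => //=.
  by rewrite in_itv/= andbT (lt_trans aq).
apply: measurableD => //.
by apply: bigcupT_measurable_rat => q; case: ifPn => // _; case: (HN q).
Qed.

End Completion.

(** * Integration with respect to the completed measure *)

Section AeEq.
Context d (T : measurableType d) (R : realType) (nu : {measure set T -> \bar R}).
Implicit Types (D : set T) (f g : T -> R).

(* [filterS] does not find the filter instance over the carrier of [leb1], which
   unfolds to the reals. *)
Lemma ae_imply (P Q : T -> Prop) : (forall x, P x -> Q x) ->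
  {ae nu, forall x, P x} -> {ae nu, forall x, Q x}.
Proof. by move=> PQ; apply: filterS. Qed.

Lemma ae_imply2 (P Q S : T -> Prop) : (forall x, P x -> Q x -> S x) ->
  {ae nu, forall x, P x} -> {ae nu, forall x, Q x} -> {ae nu, forall x, S x}.
Proof. by move=> PQ; apply: filterS2. Qed.

Lemma ae_eq_integrable D f g : measurable D ->
  nu.-integrable D (EFin \o f) -> measurable_fun D g ->
  {ae nu, forall x, D x -> f x = g x} -> nu.-integrable D (EFin \o g).
Proof.
move=> mD fi mg fg; have [mf foo] := integrableP _ _ _ fi.
apply/integrableP; split; first exact/measurable_EFinP.
rewrite (_ : (\int[nu]_(x in D) _ = \int[nu]_(x in D) `|(EFin \o f) x|)%E)//.
apply: ae_eq_integral => //.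
- by apply: measurableT_comp => //; exact/measurable_EFinP.
- exact: measurableT_comp.
- by apply: filterS fg => x /= + Dx => ->.
Qed.

Lemma ae_eq_Rintegral D f g : measurable D ->
  measurable_fun D f -> measurable_fun D g ->
  {ae nu, forall x, D x -> f x = g x} ->
  \int[nu]_(x in D) f x = \int[nu]_(x in D) g x.
Proof.
move=> mD mf mg fg; congr fine; apply: ae_eq_integral => //.
- exact/measurable_EFinP.
- exact/measurable_EFinP.
- by apply: filterS fg => x /= + Dx => ->.
Qed.

(** [le_Rintegral] asks for the inequality everywhere; [f] is therefore replaced by the minimum of
    [f] and [g], which equals it almost everywhere. *)
Lemma ae_le_Rintegral D f g : measurable D ->
  nu.-integrable D (EFin \o f) -> nu.-integrable D (EFin \o g) ->
  {ae nu, forall x, D x -> f x <= g x} ->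
  \int[nu]_(x in D) f x <= \int[nu]_(x in D) g x.
Proof.
move=> mD fi gi fg.
have mf : measurable_fun D f by exact/measurable_EFinP/(measurable_int nu).
have mg : measurable_fun D g by exact/measurable_EFinP/(measurable_int nu).
have mh : measurable_fun D (fun x => Num.min (f x) (g x)).
  exact: measurable_minr.
have fh : {ae nu, forall x, D x -> f x = Num.min (f x) (g x)}.
  by apply: filterS fg => x + Dx => /(_ Dx) ?; rewrite min_l.
rewrite (ae_eq_Rintegral mD mf mh fh); apply: le_Rintegral => //.
  exact: ae_eq_integrable fh.
by move=> x _; rewrite ge_min lexx orbT.
Qed.

Lemma le_integrable_norm D f g : measurable D -> measurable_fun D f ->
  nu.-integrable D (EFin \o g) -> (forall x, D x -> `|f x| <= g x) ->
  nu.-integrable D (EFin \o f).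
Proof.
move=> mD mf gi fg; apply: (le_integrable mD _ _ gi).
  exact/measurable_EFinP.
move=> x Dx /=; rewrite lee_fin; apply: le_trans (fg x Dx) _; exact: ler_norm.
Qed.

End AeEq.

Section Primitive.
Context {R : realType}.
Notation mu := (@lebesgue_measure R).
Notation lam := (leb1 R).
Notation LR := (caratheodory_type (@wlength R idfun)^*%mu).
Implicit Types f g : LR -> R.

(** Starting at minus infinity avoids orientation conventions for negative [t]; later arguments rely
    on increments of [prim f]. *)
Definition prim (f : LR -> R) (t : R) : R := \int[lam]_(x in `]-oo, t]) f x.

Definition integr (f : LR -> R) := lam.-integrable setT (EFin \o f).

Lemma integrP f : integr f <-> lam.-integrable setT (EFin \o f).
Proof. by []. Qed.

Lemma integr_borelP (f : R -> R) : measurable_fun setT f ->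
  integr f <-> mu.-integrable setT (EFin \o f).
Proof. by move=> mf; apply: integrable_borel_leb1 => //; exact/measurable_EFinP. Qed.

Lemma leb1_measurable_itv (i : interval R) : measurable ([set` i] : set LR).
Proof. by apply: borel_lebesgue_measurable; exact: measurable_itv. Qed.

Lemma integr_on (A : set LR) f : measurable A -> integr f ->
  lam.-integrable A (EFin \o f).
Proof. by move=> mA; apply: integrableS. Qed.

Lemma integr_itv f (i : interval R) : integr f ->
  lam.-integrable [set` i] (EFin \o f).
Proof. by move=> fi; apply: integr_on => //; exact: leb1_measurable_itv. Qed.

Lemma integr_meas f : integr f -> measurable_fun (setT : set LR) f.
Proof. by case/integrableP => /measurable_EFinP. Qed.

Lemma integrD f g : integr f -> integr g -> integr (fun x => f x + g x).
Proof. by move=> fi gi; have := integrableD measurableT fi gi. Qed.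

Lemma integrB f g : integr f -> integr g -> integr (fun x => f x - g x).
Proof. by move=> fi gi; have := integrableB measurableT fi gi. Qed.

Lemma integrZ (k : R) f : integr f -> integr (fun x => k * f x).
Proof. by move=> fi; have := integrableZl measurableT k fi. Qed.

Lemma integr_norm f : integr f -> integr (fun x => `|f x|).
Proof. by move=> fi; have := integrable_abse fi. Qed.

Lemma integr_le f g : measurable_fun (setT : set LR) f -> integr g ->
  (forall x, `|f x| <= g x) -> integr f.
Proof. by move=> mf gi fg; exact: (le_integrable_norm measurableT mf gi). Qed.

Lemma prim_sub f (s t : R) : integr f -> s <= t ->
  prim f t - prim f s = \int[lam]_(x in `]s, t]) f x.
Proof.
move=> fi st.
rewrite /prim (_ : [set` `]-oo, t]] = [set` `]-oo, s]] `|` [set` `]s, t]]); last first.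
  by rewrite -itv_bndbnd_setU// bnd_simp.
have dis : [disjoint `]-oo, s]%classic & `]s, t]%classic].
  rewrite disj_set2E; apply/eqP/seteqP; split => x //= [].
  by rewrite !in_itv/= => h /andP[]; rewrite ltNge h.
have mU : measurable (`]-oo, s] `|` `]s, t] : set LR) by apply: measurableU; exact: leb1_measurable_itv.
rewrite (Rintegral_setU (leb1_measurable_itv _) (leb1_measurable_itv _) (integr_on mU fi) dis).
by rewrite addrAC subrr add0r.
Qed.

Lemma prim_le f g (s t : R) : integr f -> integr g -> s <= t ->
  (forall x, s < x <= t -> f x <= g x) ->
  prim f t - prim f s <= prim g t - prim g s.
Proof.
move=> fi gi st fg; rewrite !prim_sub//.
apply: (le_Rintegral (leb1_measurable_itv _) (integr_itv _ fi) (integr_itv _ gi)) => x /=.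
by rewrite in_itv; exact: fg.
Qed.

Lemma ae_eq_prim f g : integr f -> measurable_fun (setT : set LR) g ->
  {ae lam, forall x, f x = g x} -> prim f = prim g.
Proof.
move=> fi mg fg; apply/funext => t; apply: (ae_eq_Rintegral (leb1_measurable_itv _)).
- by apply: measurable_funTS; exact: integr_meas.
- exact: measurable_funTS.
- by apply: ae_imply fg.
Qed.

Lemma ae_eq_integr f g : integr f -> measurable_fun (setT : set LR) g ->
  {ae lam, forall x, f x = g x} -> integr g.
Proof.
move=> fi mg fg; apply: (ae_eq_integrable measurableT fi mg).
by apply: filterS fg.
Qed.

Lemma prim_ae_le f g (s t : R) : integr f -> integr g -> s <= t ->
  {ae lam, forall x, s < x <= t -> f x <= g x} ->
  prim f t - prim f s <= prim g t - prim g s.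
Proof.
move=> fi gi st fg; rewrite !prim_sub//.
apply: (ae_le_Rintegral (leb1_measurable_itv _) (integr_itv _ fi) (integr_itv _ gi)).
by apply: ae_imply fg => x + xst; apply; move: xst; rewrite /= in_itv.
Qed.

Lemma primD f g (t : R) : integr f -> integr g ->
  prim (fun x => f x + g x) t = prim f t + prim g t.
Proof. by move=> fi gi; exact: (RintegralD (leb1_measurable_itv _) (integr_itv _ fi) (integr_itv _ gi)). Qed.

Lemma primB f g (t : R) : integr f -> integr g ->
  prim (fun x => f x - g x) t = prim f t - prim g t.
Proof. by move=> fi gi; exact: (RintegralB (leb1_measurable_itv _) (integr_itv _ fi) (integr_itv _ gi)). Qed.

Lemma primZ k f (t : R) : integr f ->
  prim (fun x => k * f x) t = k * prim f t.
Proof. by move=> fi; exact: (RintegralZl k (leb1_measurable_itv _) (integr_itv _ fi)). Qed.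

Lemma prim_norm f (s t : R) : integr f -> s <= t ->
  `|prim f t - prim f s| <= prim (fun x => `|f x|) t - prim (fun x => `|f x|) s.
Proof.
move=> fi st; rewrite !prim_sub//; last exact: integr_norm.
exact: (le_normr_Rintegral (leb1_measurable_itv _) (integr_itv _ fi)).
Qed.

Lemma prim_mono f (s t : R) : integr f -> (forall x, 0 <= f x) -> s <= t ->
  prim f s <= prim f t.
Proof.
by move=> fi f0 st; rewrite -subr_ge0 prim_sub//; apply: Rintegral_ge0.
Qed.

(** Absolute continuity of the integral; the modulus depends on the length of the interval and not
    on its position. *)
Lemma prim_unif f (e : R) : integr f -> 0 < e ->
  exists2 d, 0 < d & forall s t : R, s <= t -> t - s < d ->
    prim (fun x => `|f x|) t - prim (fun x => `|f x|) s < e.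
Proof.
move=> fi e0; have [d [d0 H]] := integral_normr_continuous fi e0.
exists d => // s t st std; rewrite prim_sub//; last exact: integr_norm.
apply: H; first exact: leb1_measurable_itv.
rewrite -[X in (X < _)%E]/(mu `]s, t]%classic) lebesgue_measure_itv/=; case: ifPn => _; last by rewrite lte_fin.
by rewrite -EFinD lte_fin.
Qed.

Lemma prim_continuous f : integr f -> continuous (prim f).
Proof.
move=> fi x; apply/cvgrPdist_lt => e e0; have [d d0 H] := prim_unif fi e0.
near=> y.
have xy : `|x - y| < d by near: y; apply: cvgr_dist_lt => //; exact: cvg_id.
have [le_xy|/ltW le_yx] := leP x y.
  rewrite distrC; apply: le_lt_trans (prim_norm fi le_xy) _; apply: H => //.
  by apply: le_lt_trans xy; rewrite distrC ler_norm.
apply: le_lt_trans (prim_norm fi le_yx) _; apply: H => //.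
by apply: le_lt_trans xy; rewrite ler_norm.
Unshelve. all: by end_near. Qed.

(** Lebesgue differentiation applies to a Borel representative; the passage to it leaves [prim f]
    unchanged and alters [f] only on a null set. *)
Lemma prim_derive f : integr f ->
  {ae lam, forall x, derivable (prim f : R -> R) x 1 /\ derive1 (prim f) x = f x}.
Proof.
move=> fi; have [g mg fg] := borel_representative (integr_meas fi).
have mg' := measurable_fun_borel_lebesgue mg measurableT.
have gi := ae_eq_integr fi mg' fg.
rewrite (ae_eq_prim fi mg' fg).
have gib : mu.-integrable setT (EFin \o g).
  by apply/integrable_borel_leb1 => //; exact/measurable_EFinP.
have := @FTC1Ny R g.
have -> : (fun x => \int[mu]_(t in `]-oo, x]) g t) = prim g.
  apply/funext => x; congr fine; rewrite integral_borel_leb1//.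
  by apply/measurable_EFinP; apply: measurable_funTS.
move=> H; have : {ae mu, forall x, derivable (prim g : R -> R) x 1 /\ derive1 (prim g) x = g x}.
  apply: H; last first.
    by have := integrable_locally (@measurableT _ R) gib; rewrite patch_setT.
  by move=> y; apply: integrableS gib => //; exact: measurable_itv.
move=> /ae_borel_leb1; apply: ae_imply2 fg => x -> //.
Qed.

End Primitive.

(* Keeps unification from unfolding integrals when it compares reals. *)
#[global] Opaque prim integr.

(** * Absolutely continuous functions have a density *)

Section Density.
Context {R : realType}.
Notation mu := (@lebesgue_measure R).
Notation lam := (leb1 R).
Notation LR := (caratheodory_type (@wlength R idfun)^*%mu).

Lemma lebesgue_stieltjes_itv (F : cumulative R R) (a b : R) : a <= b ->
  lebesgue_stieltjes_measure F `]a, b]%classic = (F b - F a)%:E.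
Proof.
move=> ab; rewrite /lebesgue_stieltjes_measure /measure_extension.
rewrite measurable_mu_extE; first exact: wlength_itv_bnd.
exact: is_ocitv.
Qed.

(** Existence is packed with uniqueness, because uniqueness is what later identifies a Stieltjes
    measure with a measure given by a density. *)
Lemma stieltjes_of (G : R -> R) : {homo G : x y / x <= y} -> continuous G ->
  exists nu : {measure set (measurableTypeR R) -> \bar R},
    (forall a b, a <= b -> nu `]a, b]%classic = (G b - G a)%:E) /\
    forall nu' : {measure set (measurableTypeR R) -> \bar R},
      (forall a b, a <= b -> nu' `]a, b]%classic = (G b - G a)%:E) ->
      forall A, measurable A -> nu A = nu' A.
Proof.
move=> ndG cG.
pose GC : cumulative R R :=
  HB.pack G (isCumulative.Build R _ R G ndG (right_continuousW cG)).
exists (lebesgue_stieltjes_measure GC); split.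
  by move=> a b; exact: lebesgue_stieltjes_itv.
move=> nu' nu'E A mA; apply: lebesgue_stieltjes_measure_unique => // _ [[a b] _ <-] /=.
have [ab|ba] := leP a b; first by rewrite lebesgue_stieltjes_itv// nu'E.
by rewrite set_itv_ge ?bnd_simp -?leNgt ?ltW// !measure0.
Qed.

Lemma density_measure (f : measurableTypeR R -> \bar R) :
  measurable_fun setT f -> (forall x, 0 <= f x)%E ->
  exists nu : {measure set (measurableTypeR R) -> \bar R},
    forall A, nu A = (\int[mu]_(x in A) f x)%E.
Proof.
move=> mf f0; pose nu (A : set (measurableTypeR R)) := (\int[mu]_(x in A) f x)%E.
have nu0 : nu set0 = 0%E by exact: integral_set0.
have nu_ge0 A : (0 <= nu A)%E by exact: integral_ge0.
have nuS : semi_sigma_additive nu.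
  move=> F mF tF mUF; rewrite [X in _ --> X](_ : _ = (\sum_(n <oo) nu (F n))%E).
    exact: is_cvg_ereal_nneg_natsum.
  by apply: ge0_integral_bigcup => //; exact: measurable_funTS.
pose nuM : {measure set (measurableTypeR R) -> \bar R} :=
  HB.pack nu (isMeasure.Build _ _ _ nu nu0 nu_ge0 nuS).
by exists nuM.
Qed.

Lemma radon_nikodym_lebesgue (nu : {measure set (measurableTypeR R) -> \bar R}) :
  (nu setT < +oo)%E -> (forall A, measurable A -> mu A = 0%E -> nu A = 0%E) ->
  exists f : measurableTypeR R -> R, [/\ forall x, 0 <= f x,
    mu.-integrable setT (EFin \o f) &
    forall A, measurable A -> nu A = (\int[mu]_(x in A) (f x)%:E)%E].
Proof.
move=> nufin nu0.
(* Restriction to the whole space changes no value; it equips [nu] with the structure of a finite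
   measure. *)
pose nuF := mfrestr (@measurableT _ (measurableTypeR R)) nufin.
have nuFE A : nuF A = nu A by rewrite /nuF /mfrestr /mrestr setIT.
have dom : nuF `<< mu.
  move=> A mA0 B mB BA; rewrite [LHS]nuFE; apply: nu0 => //.
  exact: mA0.
have [f [f0 ffin fi fE]] := radon_nikodym_sigma_finite dom.
exists (fine \o f); split.
- by move=> x; exact: fine_ge0.
- by apply: eq_integrable fi => // x _ /=; rewrite fineK.
- move=> A mA; rewrite -nuFE [LHS]fE//; apply: eq_integral => x _ /=; by rewrite fineK.
Qed.

(* The Stieltjes measures of [M + H] and [M - H], with [M = prim m], add up to
   the measure of density [2 m], so both have densities between 0 and [2 m]. *)
Lemma lipschitz_density_borel (m : R -> R) (H : R -> R) :
  measurable_fun setT m -> (forall x, 0 <= m x) -> integr m ->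
  (forall s t, s <= t -> `|H t - H s| <= prim m t - prim m s) ->
  exists h : R -> R, [/\ integr h, {ae lam, forall x, `|h x| <= m x} &
    forall s t, s <= t -> H t - H s = prim h t - prim h s].
Proof.
move=> mm m0 mi HM; set M := prim m in HM.
have cM : continuous M := prim_continuous mi.
have cH : continuous H.
  move=> x; apply/cvgrPdist_lt => e e0; near=> y.
  have : `|M x - M y| < e by near: y; apply: cvgr_dist_lt => //; exact: cM.
  apply: le_lt_trans; have [xy|/ltW yx] := leP x y.
    by rewrite distrC (le_trans (HM _ _ xy))// distrC ler_norm.
  by rewrite (le_trans (HM _ _ yx))// ler_norm.
pose G x := M x + H x; pose K x := M x - H x.
have ndG : {homo G : x y / x <= y}.
  by move=> s t st; have := HM _ _ st; rewrite /G ler_norml => /andP[]; lra.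
have ndK : {homo K : x y / x <= y}.
  by move=> s t st; have := HM _ _ st; rewrite /K ler_norml => /andP[]; lra.
have ndM : {homo (fun x => 2 * M x) : x y / x <= y}.
  by move=> s t st; rewrite ler_pM2l//; exact: prim_mono.
have cG : continuous G by move=> x; apply: cvgD; [exact: cM|exact: cH].
have cK : continuous K by move=> x; apply: cvgB; [exact: cM|exact: cH].
have c2M : continuous (fun x => 2 * M x).
  by move=> x; apply: cvgM; [exact: cvg_cst|exact: cM].
have [nuG [nuGE _]] := stieltjes_of ndG cG.
have [nuK [nuKE _]] := stieltjes_of ndK cK.
have [nuM [nuME nuMu]] := stieltjes_of ndM c2M.
have m2m : measurable_fun setT (fun x : R => (2 * m x)%:E).
  by apply/measurable_EFinP; apply: measurable_funM.
have m2ge0 (x : R) : (0 <= (2 * m x)%:E)%E by rewrite lee_fin mulr_ge0.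
have [nu2 nu2E] := density_measure m2m m2ge0.
have nu2M (A : set (measurableTypeR R)) : measurable A -> nuM A = nu2 A.
  apply: nuMu => a b ab; rewrite nu2E -integral_borel_leb1//; last exact: measurable_funTS.
  have i2 := integrZ 2 mi.
  rewrite -(fineK (integrable_fin_num (leb1_measurable_itv _) (integr_itv _ i2))).
  congr EFin; rewrite -[LHS]/(\int[lam]_(x in `]a, b]) (2 * m x)).
  by rewrite -prim_sub// !primZ.
have nuGK (A : set (measurableTypeR R)) : measurable A ->
    (nuG A + nuK A = \int[mu]_(x in A) (2 * m x)%:E)%E.
  move=> mA; rewrite -nu2E -nu2M//.
  rewrite -[LHS](measure_addE nuG nuK); apply/esym; apply: nuMu => // a b ab.
  by rewrite [LHS](measure_addE nuG nuK) nuGE// nuKE// -EFinD /G /K; congr EFin; ring.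
have i2b : mu.-integrable setT (fun x : R => (2 * m x)%:E).
  have m2 : measurable_fun setT (fun x : R => 2 * m x) by apply: measurable_funM.
  by have /(integr_borelP m2) := integrZ 2 mi.
have fin2 : (\int[mu]_x (2 * m x)%:E < +oo)%E.
  by have := integrable_fin_num measurableT i2b; rewrite ge0_fin_numE// integral_ge0.
have zero2 (A : set (measurableTypeR R)) : measurable A -> mu A = 0%E ->
    (\int[mu]_(x in A) (2 * m x)%:E)%E = 0%E.
  by move=> mA A0; apply: null_set_integral => //; exact: measurable_funTS.
(* [nuG] is at most [nuG + nuK], the measure of density [2 m], which is finite and vanishes on null
   sets. This makes Radon-Nikodym applicable to [nuG], and likewise to [nuK]. *)
have [g [g0 gi gE]] : exists f : measurableTypeR R -> R, [/\ forall x, 0 <= f x,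
    mu.-integrable setT (EFin \o f) &
    forall A, measurable A -> nuG A = (\int[mu]_(x in A) (f x)%:E)%E].
  apply: radon_nikodym_lebesgue => [|A mA A0].
    by apply: le_lt_trans fin2; rewrite -nuGK// leeDl.
  by apply/eqP; rewrite eq_le measure_ge0 andbT -(zero2 _ mA A0) -nuGK// leeDl.
have [k [k0 ki kE]] : exists f : measurableTypeR R -> R, [/\ forall x, 0 <= f x,
    mu.-integrable setT (EFin \o f) &
    forall A, measurable A -> nuK A = (\int[mu]_(x in A) (f x)%:E)%E].
  apply: radon_nikodym_lebesgue => [|A mA A0].
    by apply: le_lt_trans fin2; rewrite -nuGK// leeDr.
  by apply/eqP; rewrite eq_le measure_ge0 andbT -(zero2 _ mA A0) -nuGK// leeDr.
have mg : measurable_fun (setT : set R) g.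
  by apply/measurable_EFinP; exact: (measurable_int mu).
have mk : measurable_fun (setT : set R) k.
  by apply/measurable_EFinP; exact: (measurable_int mu).
have gil : integr g.
  exact/integr_borelP.
have gk : {ae lam, forall x, g x + k x = 2 * m x}.
  apply: ae_borel_leb1.
  have : ae_eq mu setT (fun x => (g x)%:E + (k x)%:E)%E (fun x : R => (2 * m x)%:E).
    apply: integral_ae_eq => //; first exact: integrableD gi ki.
    move=> E _ mE; rewrite -nuGK// gE// kE// ge0_integralD//.
    - by move=> x _; rewrite lee_fin.
    - by apply/measurable_EFinP; exact: measurable_funTS.
    - by move=> x _; rewrite lee_fin.
    - by apply/measurable_EFinP; exact: measurable_funTS.
  by apply: ae_imply => x /= /(_ I)[].
(* [g] is the density of [M + H], so [g - m] is that of [H]; the bound comes from [0 <= g <= 2 m],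
   valid almost everywhere. *)
exists (fun x => g x - m x); split; first exact: integrB.
  apply: ae_imply gk => x; have := g0 x; have := k0 x; rewrite ler_norml.
  by move=> ? ? ?; apply/andP; split; lra.
move=> s t st; rewrite !primB//.
suff : G t - G s = prim g t - prim g s.
  by rewrite /G -/M; lra.
rewrite prim_sub//; apply: EFin_inj; rewrite -nuGE// gE; last exact: measurable_itv.
rewrite -integral_borel_leb1//; last first.
  by apply/measurable_EFinP; exact: measurable_funTS.
by rewrite -[LHS](fineK (integrable_fin_num (leb1_measurable_itv _) (integr_itv _ gil))).
Unshelve. all: by end_near. Qed.

(** The Borel density is clamped between [-m] and [m], so that the bound holds at every point. Hence
    [h] vanishes wherever [m] does, which is how densities will be seen to live on []0, T[]. *)
Lemma lipschitz_density (m : LR -> R) (H : R -> R) :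
  (forall x, 0 <= m x) -> integr m ->
  (forall s t, s <= t -> `|H t - H s| <= prim m t - prim m s) ->
  exists h : LR -> R, [/\ integr h, forall x, `|h x| <= m x &
    forall s t, s <= t -> H t - H s = prim h t - prim h s].
Proof.
move=> m0 mi HM; have [m1 mm1 mE1] := borel_representative (integr_meas mi).
pose m' x := Num.max (m1 x) 0.
have mm' : measurable_fun (setT : set R) m' by apply: measurable_maxr.
have mm'l := measurable_fun_borel_lebesgue mm' measurableT.
have mm'E : {ae lam, forall x, m x = m' x}.
  by apply: ae_imply mE1 => x E; rewrite /m' -E max_l.
have m'0 x : 0 <= m' x by rewrite le_max lexx orbT.
have [|h0 [h0i h0m h0E]] := lipschitz_density_borel mm' m'0 (ae_eq_integr mi mm'l mm'E) (H := H).
  by move=> s t st; rewrite -(ae_eq_prim mi mm'l mm'E); exact: HM.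
pose h x := Num.max (- m x) (Num.min (h0 x) (m x)).
have mh : measurable_fun (T := LR) setT h.
  apply: measurable_maxr; last apply: measurable_minr.
  - by apply: measurableT_comp => //; exact: integr_meas.
  - exact: integr_meas.
  - exact: integr_meas.
have hE : {ae lam, forall x, h0 x = h x}.
  apply: ae_imply2 h0m mm'E => x + mE; rewrite -mE ler_norml => /andP[h1 h2].
  by rewrite /h min_l// max_r.
exists h; split; first exact: ae_eq_integr hE.
  move=> x; rewrite ler_norml /h le_max lexx/= ge_max ge_min lexx orbT andbT.
  by rewrite (le_trans _ (m0 x))// oppr_le0.
by move=> s t st; rewrite -(ae_eq_prim h0i mh hE); exact: h0E.
Qed.

End Density.

(** * Product rule for absolutely continuous functions *)

Section AbsolutelyContinuous.
Context {R : realType}.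
Notation mu := (@lebesgue_measure R).
Notation lam := (leb1 R).
Notation LR := (caratheodory_type (@wlength R idfun)^*%mu).
Implicit Types (a b f g w : LR -> R) (s t x : R).

Lemma prim_bounded f : integr f -> exists C, forall t, `|prim f t| <= C.
Proof.
move=> fi; exists (\int[lam]_x `|f x|) => t.
apply: le_trans (le_normr_Rintegral (leb1_measurable_itv _) (integr_itv _ fi)) _.
rewrite Rintegral_mkcond; apply: le_Rintegral.
- exact: measurableT.
- rewrite -restrict_EFin; apply/(integrable_mkcond _ (leb1_measurable_itv _)).
  exact: integr_itv (integr_norm fi).
- exact: integr_norm.
- by move=> x _; rewrite patchE; case: ifP => _; [exact: lexx|exact: normr_ge0].
Qed.

Lemma measurable_leb1_continuous (f : R -> R) : continuous f ->
  measurable_fun (T := LR) setT f.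
Proof.
move=> cf; apply: measurable_fun_borel_lebesgue measurableT.
exact: continuous_measurable_fun.
Qed.

Lemma integrM_bounded f g (C : R) : integr f -> measurable_fun (T := LR) setT g ->
  (forall x, `|g x| <= C) -> integr (fun x => f x * g x).
Proof.
move=> fi mg gC; apply: (@integr_le _ _ (fun x => C * `|f x|)).
- by apply: measurable_funM => //; exact: integr_meas.
- exact/integrZ/integr_norm.
- by move=> x; rewrite normrM mulrC; apply: ler_wpM2r.
Qed.

Lemma integrM_continuous f (g : R -> R) : integr f -> continuous g ->
  (exists C, forall x, `|g x| <= C) -> integr (fun x => f x * g x).
Proof.
move=> fi cg [C gC]; apply: (integrM_bounded fi _ gC).
exact: measurable_leb1_continuous.
Qed.

Lemma integr_centered a (B : R -> R) (c : R) : integr a -> continuous B ->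
  (exists C, forall x, `|B x| <= C) -> integr (fun x => a x * (c - B x)).
Proof.
move=> ai cB [C BC]; apply: integrM_continuous => //.
  by move=> x; apply: cvgB; [exact: cvg_cst|exact: cB].
exists (`|c| + C) => x; apply: le_trans (ler_normB _ _) _.
exact: lerD (lexx _) (BC x).
Qed.

(** With [c] the value of [B] at an endpoint of the interval, the left side is one of the two error
    terms in the product rule. *)
Lemma prim_centered a (B : R -> R) (c : R) s t : integr a ->
  integr (fun x => a x * B x) ->
  prim (fun x => a x * (c - B x)) t - prim (fun x => a x * (c - B x)) s =
  c * (prim a t - prim a s) -
  (prim (fun x => a x * B x) t - prim (fun x => a x * B x) s).
Proof.
move=> ai aBi; rewrite (_ : (fun x => a x * (c - B x)) = fun x => c * a x - a x * B x).
  rewrite !primB; [|exact: integrZ|exact: aBi|exact: integrZ|exact: aBi].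
  rewrite !primZ; [|exact: ai|exact: ai]; ring.
by apply/funext => x; ring.
Qed.

(* Sum the local estimates over a fine partition. *)
Lemma locally_small_const (E N : R -> R) s t : s <= t ->
  (forall e, 0 < e -> exists2 d, 0 < d & forall x y, s <= x -> x <= y -> y <= t ->
     y - x < d -> `|E y - E x| <= e * (N y - N x)) -> E t = E s.
Proof.
move=> st H.
have bound e : 0 < e -> `|E t - E s| <= e * (N t - N s).
  move=> e0; have [d d0 Hd] := H e e0.
  have [n tsn] : exists n : nat, (t - s) / n.+1%:R < d.
    exists (Num.bound ((t - s) / d)).
    rewrite ltr_pdivrMr// -ltr_pdivrMl// mulrC.
    apply: (@lt_trans _ _ (Num.bound ((t - s) / d))%:R); last by rewrite ltr_nat.
    by apply: archi_boundP; rewrite divr_ge0// ?subr_ge0// ltW.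
  pose q := (t - s) / n.+1%:R.
  have q0 : 0 <= q by rewrite divr_ge0// subr_ge0.
  have qn : n.+1%:R * q = t - s by rewrite /q mulrC divfK.
  have ind i : (i <= n.+1)%N -> `|E (s + i%:R * q) - E s| <= e * (N (s + i%:R * q) - N s).
    elim: i => [_|i IH lein].
      by rewrite mul0r addr0 !subrr normr0 mulr0.
    have ilt := IH (ltnW lein).
    have step : `|E (s + i.+1%:R * q) - E (s + i%:R * q)|
        <= e * (N (s + i.+1%:R * q) - N (s + i%:R * q)).
      apply: Hd.
      - by rewrite lerDl mulr_ge0.
      - by rewrite lerD2l ler_wpM2r// ler_nat.
      - by rewrite -lerBrDl -qn ler_wpM2r// ler_nat.
      - by rewrite opprD addrACA subrr add0r -mulrBl -natrB// subSnn mul1r.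
    have split3 (F : R -> R) u v : F u - F s = (F u - F v) + (F v - F s) by ring.
    rewrite (split3 E _ (s + i%:R * q)) (split3 N _ (s + i%:R * q)) mulrDr.
    exact: le_trans (ler_normD _ _) (lerD step ilt).
  by have := ind _ (leqnn _); rewrite qn addrCA subrr addr0.
apply/eqP; rewrite -subr_eq0 -normr_eq0 eq_le normr_ge0 andbT.
apply/ler_addgt0Pr => e e0; rewrite add0r.
(* The summand 1 covers the case where [N] has no increment. *)
have NN0 : 0 < `|N t - N s| + 1 by rewrite ltr_wpDl.
apply: le_trans (bound (e / (`|N t - N s| + 1)) _) _; first by rewrite divr_gt0.
rewrite -mulrA ler_piMr ?(ltW e0)// mulrC ler_pdivrMr// mul1r.
by rewrite (le_trans (ler_norm _))// lerDl.
Qed.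

(** From [x] to [y] the difference between the product [A B] and the primitive of [a B + b A]
    changes by the integral of [a (B y - B) + b (A x - A)]. For close [x] and [y] both brackets are
    at most [e], so this is at most [e] times the increment of the primitive of [|a| + |b|], and
    [locally_small_const] applies. *)
Lemma prim_parts a b (al be : R) s t : integr a -> integr b -> s <= t ->
  (al + prim a t) * (be + prim b t) - (al + prim a s) * (be + prim b s) =
  prim (fun x => a x * (be + prim b x) + b x * (al + prim a x)) t -
  prim (fun x => a x * (be + prim b x) + b x * (al + prim a x)) s.
Proof.
move=> ai bi st.
have bdd (f : LR -> R) c : integr f -> exists C, forall x, `|c + prim f x| <= C.
  move=> fi; have [C HC] := prim_bounded fi; exists (`|c| + C) => x.
  by rewrite (le_trans (ler_normD _ _))// lerD.
have cont (f : LR -> R) c : integr f -> continuous (fun x => c + prim f x).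
  by move=> fi x; apply: cvgD; [exact: cvg_cst|exact: prim_continuous].
pose A x := al + prim a x; pose B x := be + prim b x.
have aBi : integr (fun x => a x * B x).
  by apply: integrM_continuous => //; [exact: cont|exact: bdd].
have bAi : integr (fun x => b x * A x).
  by apply: integrM_continuous => //; [exact: cont|exact: bdd].
pose G x := a x * B x + b x * A x.
have swap (p q r u : R) : p - r = q - u -> p - q = r - u by lra.
apply: (swap (A t * B t) (A s * B s) (prim G t) (prim G s)).
apply: (@locally_small_const (fun r => A r * B r - prim G r)
  (prim (fun x => `|a x| + `|b x|)) _ _ st) => e e0.
have [d1 d10 H1] := prim_unif ai e0; have [d2 d20 H2] := prim_unif bi e0.
exists (Num.min d1 d2) => [|x y sx xy yt]; first by rewrite lt_min d10.
rewrite lt_min => /andP[yx1 yx2].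
have i1 : integr (fun r => a r * (B y - B r)).
  by apply: integr_centered; [exact: ai|exact: cont|exact: bdd].
have i2 : integr (fun r => b r * (A x - A r)).
  by apply: integr_centered; [exact: bi|exact: cont|exact: bdd].
have E1 := prim_centered (B y) x y ai aBi.
have E2 := prim_centered (A x) x y bi bAi.
have EG r : prim G r = prim (fun x => a x * B x) r + prim (fun x => b x * A x) r.
  exact: primD.
have EA : A y - A x = prim a y - prim a x by rewrite /A; ring.
have EB : B y - B x = prim b y - prim b x by rewrite /B; ring.
rewrite -EA in E1; rewrite -EB in E2.
have -> : A y * B y - prim G y - (A x * B x - prim G x) =
    (prim (fun r => a r * (B y - B r)) y - prim (fun r => a r * (B y - B r)) x) +
    (prim (fun r => b r * (A x - A r)) y - prim (fun r => b r * (A x - A r)) x).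
  have alg (Ax Ay Bx By p q r u v1 v2 gy gx : R) :
      v1 = By * (Ay - Ax) - (p - r) -> v2 = Ax * (By - Bx) - (q - u) ->
      gy = p + q -> gx = r + u -> Ay * By - gy - (Ax * Bx - gx) = v1 + v2.
    by move=> -> -> -> ->; ring.
  exact: (alg _ _ _ _ _ _ _ _ _ _ _ _ E1 E2 (EG y) (EG x)).
have -> : prim (fun x => `|a x| + `|b x|) y - prim (fun x => `|a x| + `|b x|) x =
   (prim (fun x => `|a x|) y - prim (fun x => `|a x|) x) +
   (prim (fun x => `|b x|) y - prim (fun x => `|b x|) x).
  rewrite !primD; try exact: integr_norm.
  by ring.
rewrite mulrDr; apply: le_trans (ler_normD _ _) _.
apply: lerD.
- rewrite mulrBr -!primZ; try exact: integr_norm.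
  apply: le_trans (prim_norm i1 xy) _; apply: prim_le => //.
  + exact: integr_norm.
  + exact/integrZ/integr_norm.
  + move=> r /andP[xr ry]; rewrite normrM mulrC ler_wpM2r//.
    have -> : B y - B r = prim b y - prim b r by rewrite /B; ring.
    apply: le_trans (prim_norm bi ry) _; apply/ltW/H2 => //.
    by apply: le_lt_trans yx2; rewrite lerD2l lerN2 ltW.
- rewrite mulrBr -!primZ; try exact: integr_norm.
  apply: le_trans (prim_norm i2 xy) _; apply: prim_le => //.
  + exact: integr_norm.
  + exact/integrZ/integr_norm.
  + move=> r /andP[xr ry]; rewrite normrM mulrC ler_wpM2r//.
    have -> : A x - A r = - (prim a r - prim a x) by rewrite /A; ring.
    rewrite normrN; apply: le_trans (prim_norm ai (ltW xr)) _; apply/ltW/H1 => //.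
      exact: ltW.
    by apply: le_lt_trans yx1; rewrite lerD2r.
Qed.

End AbsolutelyContinuous.

(** * Comparison principle *)

Section Stop.
Context {R : realType}.
Notation mu := (@lebesgue_measure R).
Notation lam := (leb1 R).
Notation LR := (caratheodory_type (@wlength R idfun)^*%mu).
Implicit Types (f g w : LR -> R) (s t x : R).

Lemma ae_neq x : {ae lam, forall t, t <> x}.
Proof.
apply: ae_borel_leb1; exists [set x]; split => //.
  exact: lebesgue_measure_set1.
by move=> t /= /contrapT.
Qed.

(** This lemma and the next three replace the subdifferential by sign conditions: [y] lies in
    [[-1, 1]], [u] is nonnegative unless [y = -1], and nonpositive unless [y = 1]. *)
Lemma subdiff_chi_domain (y u : R) : subdiff_chi y u -> -1 <= y <= 1.
Proof.
rewrite /subdiff_chi; have [->|_] := eqVneq y 1; first by move=> _; apply/andP; split; lra.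
have [->|_] := eqVneq y (-1); first by move=> _; apply/andP; split; lra.
by case: ifPn => //; rewrite ltr_norml => /andP[? ?] _; rewrite !ltW.
Qed.

Lemma subdiff_chi_ge0 (y u : R) : subdiff_chi y u -> -1 < y -> 0 <= u.
Proof.
rewrite /subdiff_chi; have [->//|_] := eqVneq y 1.
have [->|_] := eqVneq y (-1); first by rewrite ltxx.
by case: ifPn => // _ ->.
Qed.

Lemma subdiff_chi_le0 (y u : R) : subdiff_chi y u -> y < 1 -> u <= 0.
Proof.
rewrite /subdiff_chi; have [->|_] := eqVneq y 1; first by rewrite ltxx.
by have [->//|_] := eqVneq y (-1); case: ifPn => // _ ->.
Qed.

Lemma subdiff_chiI (y u : R) : -1 <= y <= 1 -> (-1 < y -> 0 <= u) ->
  (y < 1 -> u <= 0) -> subdiff_chi y u.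
Proof.
move=> /andP[y1 y2] u1 u2; rewrite /subdiff_chi.
have [yE|yn1] := eqVneq y 1; first by apply: u1; rewrite yE; lra.
have [yE|yn2] := eqVneq y (-1); first by apply: u2; rewrite yE; lra.
have ylt : -1 < y by rewrite lt_neqAle eq_sym yn2.
have ygt : y < 1 by rewrite lt_neqAle yn1.
rewrite ltr_norml ylt ygt /=; apply/eqP; rewrite eq_le u2// u1//.
Qed.

(** Since [D] is derivable at [x], its derivative is the limit of the right difference quotients,
    which are nonnegative for small steps. *)
Lemma ge0_derive1_right (D : R -> R) x d : 0 < d -> derivable D x 1 ->
  (forall t, x < t -> t < x + d -> D x <= D t) -> 0 <= derive1 D x.
Proof.
move=> d0 dD DD; rewrite derive1E ['D_1 D x]cvg_at_rightE//.
apply: limr_ge.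
  rewrite -(cvg_at_rightE (fun h : R => h^-1 *: ((D \o shift x) _ - D x)))//.
  apply: cvg_trans dD; apply: cvg_app.
  move=> A [e egt0 Ae]; exists e => // y ye ygt0; apply: Ae => //.
  exact/lt0r_neq0.
near=> h; apply: mulr_ge0.
  by rewrite invr_ge0; apply: ltW; near: h; exists 1 => /=.
rewrite subr_ge0 [_%:A]mulr1; apply: DD.
  by rewrite /= ltrDr; near: h; exists 1 => /=.
by rewrite /= addrC ltrD2l; near: h; exact: nbhs_right_lt.
Unshelve. all: by end_near. Qed.

Lemma continuous_gt (F : R -> R) x (m : R) : continuous F -> m < F x ->
  exists2 d, 0 < d & forall r, `|x - r| < d -> m < F r.
Proof.
move=> cF mF; have /cvgrPdist_lt/(_ (F x - m)) := cF x.
rewrite subr_gt0 => /(_ mF)[d /= d0 H]; exists d => // r xr.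
by have := H _ xr; rewrite ltr_distl => /andP[]; lra.
Qed.

(* Integrate over the interval following the last zero: no chain rule is
   needed for the positive part. *)
Lemma prim_pos_le (z : R) w g t : 0 <= t -> integr w -> integr g ->
  (forall r, 0 <= g r) ->
  {ae lam, forall r, 0 < r < t -> 0 < z + (prim w r - prim w 0) -> w r <= g r} ->
  z + (prim w t - prim w 0) <= Num.max z 0 + (prim g t - prim g 0).
Proof.
move=> t0 wi gi g0 wg; pose Z r := z + (prim w r - prim w 0).
have cZ : continuous Z.
  move=> r; apply: cvgD; first exact: cvg_cst.
  by apply: cvgB; [exact: prim_continuous|exact: cvg_cst].
have g_mono s : s <= t -> 0 <= prim g t - prim g s.
  by move=> st; rewrite subr_ge0; exact: prim_mono.
have step s : 0 <= s -> s <= t -> (forall r, s < r -> r <= t -> 0 < Z r) ->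
    Z t - Z s <= prim g t - prim g s.
  move=> s0 st Zpos; rewrite (_ : Z t - Z s = prim w t - prim w s); last first.
    by rewrite /Z; ring.
  (* The hypothesis covers [r < t] only; the remaining point [r = t] is null. *)
  apply: prim_ae_le => //; apply: ae_imply2 wg (ae_neq t) => r H rt /andP[sr rlet].
  apply: H; last exact: Zpos.
  by rewrite (le_lt_trans s0 sr)/= lt_neqAle rlet andbT; apply/eqP.
pose A := [set s | 0 <= s <= t /\ Z s <= 0].
(* If [Z] is never nonpositive, the integration starts at 0 and the initial value [z] enters the
   bound; otherwise it starts at [sup A]. *)
have [A0|/set0P A0] := eqVneq A set0.
  have pos r : 0 <= r -> r <= t -> 0 < Z r.
    move=> r0 rt; rewrite ltNge; apply/negP => Zr.
    suff : A r by rewrite A0.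
    by split => //; rewrite r0 rt.
  have Z0 : Z 0 = z by rewrite /Z; ring.
  have := step 0 (lexx _) t0; rewrite Z0 => H.
  have {}H : Z t - z <= prim g t - prim g 0.
    by apply: H => r r0 rt; apply: pos => //; exact: ltW.
  have : z <= Num.max z 0 by rewrite le_max lexx.
  by rewrite -/(Z t); lra.
have supA : has_sup A by split=> //; exists t => r [/andP[]].
pose s := sup A.
have [a0 Aa0] := A0.
have s0 : 0 <= s.
  by have [/andP[a00 _] _] := Aa0; exact: le_trans a00 (ub_le_sup supA.2 Aa0).
have st : s <= t by apply: ge_sup => // r [/andP[]].
(* By continuity a positive value at [s] would persist just to the left of [s], where [A] has
   points. *)
have Zs : Z s <= 0.
  rewrite leNgt; apply/negP => /(continuous_gt cZ)[d d0 Hd].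
  have [a Aa sa] := sup_adherent d0 supA.
  have as_ : a <= s by apply: ub_le_sup Aa; exact: supA.2.
  have : 0 < Z a.
    by apply: Hd; rewrite ger0_norm ?subr_ge0//; move: sa; rewrite -/s; lra.
  by case: Aa => _ Za; rewrite ltNge Za.
have {}H : Z t - Z s <= prim g t - prim g s.
  apply: step => // r sr rt; rewrite ltNge; apply/negP => Zr.
  have : A r by split => //; rewrite rt andbT (le_trans s0)// ltW.
  by move=> /(ub_le_sup supA.2); rewrite leNgt sr.
have gs : prim g 0 <= prim g s by exact: prim_mono.
have m0 : 0 <= Num.max z 0 by rewrite le_max lexx orbT.
rewrite -/(Z t); move: H Zs gs m0; clear; lra.
Qed.

(** Where the first state exceeds the second, the first is above -1 and the second below 1, so
    [f1 - w1 >= 0] and [f2 - w2 <= 0]. Hence [w1 - w2 <= f1 - f2 <= g] there, which is the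
    hypothesis of [prim_pos_le]. *)
Lemma inclusion_compare (y1 y2 T : R) w1 w2 f1 f2 g :
  integr w1 -> integr w2 -> integr g -> (forall r, 0 <= g r) ->
  {ae lam, forall t, 0 < t < T ->
     subdiff_chi (y1 + (prim w1 t - prim w1 0)) (f1 t - w1 t)} ->
  {ae lam, forall t, 0 < t < T ->
     subdiff_chi (y2 + (prim w2 t - prim w2 0)) (f2 t - w2 t)} ->
  {ae lam, forall t, 0 < t < T -> f1 t - f2 t <= g t} ->
  forall t, 0 <= t <= T ->
  y1 + (prim w1 t - prim w1 0) - (y2 + (prim w2 t - prim w2 0)) <=
    Num.max (y1 - y2) 0 + (prim g t - prim g 0).
Proof.
move=> w1i w2i gi g0 H1 H2 Hf t /andP[t0 tT].
have wE r : (y1 - y2) + (prim (fun x => w1 x - w2 x) r - prim (fun x => w1 x - w2 x) 0) =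
    y1 + (prim w1 r - prim w1 0) - (y2 + (prim w2 r - prim w2 0)).
  by rewrite !primB//; ring.
rewrite -wE; apply: prim_pos_le => //; first exact: integrB.
have H12 := ae_imply2 (fun r a b => conj a b) H1 H2.
apply: ae_imply2 H12 Hf => r [/= h1 h2] hf /andP[r0 rt]; rewrite wE => lt12.
have rT : 0 < r < T by rewrite r0 (lt_le_trans rt).
have {}h1 := h1 rT; have {}h2 := h2 rT; have {}hf := hf rT.
have /andP[d1 _] := subdiff_chi_domain h2; have /andP[_ d2] := subdiff_chi_domain h1.
have := subdiff_chi_ge0 h1; have := subdiff_chi_le0 h2.
move: d1 d2 lt12 hf; clear.
set Y1 := y1 + _; set Y2 := y2 + _ => d1 d2 lt12 hf hb ha.
have {}ha := ha ltac:(lra); have {}hb := hb ltac:(lra); lra.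
Qed.

End Stop.

(** * Existence of the play and stop operators *)

Section Existence.
Context {R : realType}.
Notation mu := (@lebesgue_measure R).
Notation lam := (leb1 R).
Notation LR := (caratheodory_type (@wlength R idfun)^*%mu).
Implicit Types (f g w : LR -> R) (s t x : R).

(* The play operator [c = y - F] follows the moving obstacles
   [-1 - F <= c <= 1 - F]; iterating the truncations
   [c |-> max (-1 - F t) (min (1 - F t) c)] gives
   [c t = sup_(s <= t) min (a s) (inf_(s <= r <= t) (1 - F r))] with
   [a 0 = x] and [a s = -1 - F s] for [s > 0]. *)
Lemma play_exists (F : R -> R) x : F 0 = 0 -> -1 <= x <= 1 ->
  exists c : R -> R, [/\ c 0 = x,
    forall t, 0 <= t -> -1 - F t <= c t <= 1 - F t,
    forall s t M, 0 <= s -> s <= t ->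
      (forall r, s <= r -> r <= t -> -1 - F r <= M) -> c t <= Num.max (c s) M &
    forall s t m, 0 <= s -> s <= t ->
      (forall r, s <= r -> r <= t -> m <= 1 - F r) -> Num.min (c s) m <= c t].
Proof.
move=> F0 /andP[x1 x2].
pose a s := if s == 0 then x else -1 - F s.
have a_ge s : -1 - F s <= a s by rewrite /a; case: eqP => // ->; rewrite F0; lra.
have a_le s : a s <= 1 - F s by rewrite /a; case: eqP => [->|_]; rewrite ?F0; lra.
pose S t := [set v | exists s, [/\ 0 <= s, s <= t, v <= a s &
  forall r, s <= r -> r <= t -> v <= 1 - F r]].
pose c t := sup (S t).
have Sub t : ubound (S t) (1 - F t) by move=> v [s [s0 st _]]; apply.
have Sa t : 0 <= t -> S t (a t).
  move=> t0; exists t; split => // r tr rt.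
  by have -> : r = t by apply/eqP; rewrite eq_le rt.
have hs t : 0 <= t -> has_sup (S t).
  by move=> t0; split; [exists (a t); exact: Sa|exists (1 - F t); exact: Sub].
have c_ge t v : 0 <= t -> S t v -> v <= c t.
  by move=> t0 Sv; apply: ub_le_sup => //; exact: (hs t t0).2.
have c_le t M : 0 <= t -> (forall v, S t v -> v <= M) -> c t <= M.
  by move=> t0 H; apply: ge_sup; [exact: (hs t t0).1|exact: H].
exists c; split.
- apply/eqP; rewrite eq_le; apply/andP; split.
    apply: c_le => // v [s [s0 st va _]].
    have s00 : s = 0 by apply/eqP; rewrite eq_le st.
    by move: va; rewrite s00 /a eqxx.
  have -> : x = a 0 by rewrite /a eqxx.
  by apply: c_ge => //; exact: Sa.
- move=> t t0; apply/andP; split.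
    by apply: le_trans (a_ge t) _; apply: c_ge => //; exact: Sa.
  by apply: c_le => // v; exact: Sub.
- move=> s t M s0 st HM; have t0 := le_trans s0 st.
  apply: c_le => // v [r [r0 rt va vb]]; rewrite le_max.
  (* A candidate started at [r <= s] already competes at time [s]; one started later is at most the
     lower obstacle at [r], hence at most [M]. *)
  have [rs|sr] := leP r s.
    apply/orP; left; apply: c_ge => //; exists r; split => // q rq qs.
    by apply: vb => //; exact: le_trans qs st.
  apply/orP; right; apply: le_trans va _; rewrite /a gt_eqF ?(le_lt_trans s0)//.
  by apply: HM => //; exact: ltW.
- move=> s t m s0 st Hm; have t0 := le_trans s0 st.
  rewrite leNgt; apply/negP; rewrite lt_min => /andP[cs cm].
  (* If some [v] in [S s] exceeded [c t], then the minimum of [v] and [m] would belong to [S t] and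
     still exceed [c t]. *)
  have : c s <= c t.
    apply: c_le => // v [r [r0 rs va vb]].
    rewrite leNgt; apply/negP => cv.
    have : Num.min v m <= c t.
      apply: c_ge => //; exists r; split => //; first exact: le_trans rs st.
        by rewrite ge_min va.
      move=> q rq qt; have [qs|sq] := leP q s; first by rewrite ge_min vb.
      by rewrite ge_min (Hm q) ?orbT// ltW.
    by rewrite leNgt lt_min cv cm.
  by rewrite leNgt cs.
Qed.

Lemma derive1_le_right (G H : R -> R) t d : 0 < d ->
  derivable G t 1 -> derivable H t 1 ->
  (forall r, t < r -> r < t + d -> G r - G t <= H r - H t) ->
  derive1 G t <= derive1 H t.
Proof.
move=> d0 dG dH GH; rewrite -subr_ge0 !derive1E -deriveB// -derive1E.
apply: (ge0_derive1_right d0); first exact: derivableB.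
by move=> r tr rd; have := GH r tr rd; rewrite !fctE; lra.
Qed.

(** The state is [c + F] with [c] the play of [F]. On an interval each obstacle moves by at most the
    increment of [N], the primitive of [|f|], and so does [c]. The factor 2 adds the share of [c] to
    that of [F]. *)
Lemma stop_exists f x : integr f -> -1 <= x <= 1 ->
  exists w, [/\ integr w, forall r, `|w r| <= 2 * `|f r|,
    forall t, 0 <= t -> -1 <= x + (prim w t - prim w 0) <= 1 &
    {ae lam, forall t, 0 < t ->
      subdiff_chi (x + (prim w t - prim w 0)) (f t - w t)}].
Proof.
move=> fi xI; pose F t := prim f t - prim f 0.
have F0 : F 0 = 0 by rewrite /F subrr.
have cF : continuous F.
  by move=> t; apply: cvgB; [exact: prim_continuous|exact: cvg_cst].
have [c [c0 cI cA cB]] := play_exists F0 xI.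
have FE r s : F r - F s = prim f r - prim f s by rewrite /F; ring.
pose N t := prim (fun r => `|f r|) t.
have NE t : prim (fun r => `|f r|) t = N t by [].
have FN s t : s <= t -> `|F t - F s| <= N t - N s.
  by move=> st; rewrite FE; exact: prim_norm.
clearbody F N.
have N_mono s t : s <= t -> N s <= N t.
  by move=> st; rewrite -subr_ge0; apply: le_trans (FN s t st).
have cN s t : 0 <= s -> s <= t -> `|c t - c s| <= N t - N s.
  move=> s0 st; have /andP[cs1 cs2] := cI s s0.
  have bound r : s <= r -> r <= t -> - (N t - N s) <= F r - F s <= N t - N s.
    move=> sr rt; rewrite -ler_norml; apply: le_trans (FN _ _ sr) _.
    by rewrite lerD2r N_mono.
  have N0 : N s <= N t by exact: N_mono.
  have := cA s t (c s + (N t - N s)) s0 st; have := cB s t (c s - (N t - N s)) s0 st.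
  rewrite max_r; last by lra.
  rewrite min_r; last by lra.
  move=> H1 H2; rewrite ler_norml; apply/andP; split.
    have : c s - (N t - N s) <= c t.
      by apply: H1 => r sr rt; have /andP[] := bound r sr rt; lra.
    by lra.
  have : c t <= c s + (N t - N s).
    by apply: H2 => r sr rt; have /andP[] := bound r sr rt; lra.
  by lra.
(* The state is frozen for negative times because [lipschitz_density] works on the whole line. *)
pose y t := c (Num.max t 0) + F (Num.max t 0).
have max0 (t : R) : 0 <= Num.max t 0 by rewrite le_max lexx orbT.
have yN s t : s <= t ->
    `|y t - y s| <= prim (fun r => 2 * `|f r|) t - prim (fun r => 2 * `|f r|) s.
  move=> st; rewrite !primZ; try exact: integr_norm.
  rewrite !NE.
  have st' : Num.max s 0 <= Num.max t 0 by rewrite ge_max !le_max st lexx orbT.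
  have : N (Num.max t 0) - N (Num.max s 0) <= N t - N s.
    have [t0|t0] := leP t 0.
      rewrite max_r; last exact: le_trans t0.
      by rewrite subrr subr_ge0 N_mono.
    have [s0|s0] := leP s 0; last by [].
    by rewrite lerD2l lerN2; exact: N_mono.
  have -> : y t - y s = (c (Num.max t 0) - c (Num.max s 0)) +
      (F (Num.max t 0) - F (Num.max s 0)) by rewrite /y; ring.
  move=> H; apply: le_trans (ler_normD _ _) _.
  by have := cN _ _ (max0 s) st'; have := FN _ _ st'; lra.
have i2 : integr (fun r => 2 * `|f r|) by exact/integrZ/integr_norm.
have m20 r : 0 <= 2 * `|f r| by rewrite mulr_ge0.
have y_pos t : 0 <= t -> y t = c t + F t by move=> t0; rewrite /y max_l.
clearbody y.
have [w [wi wm wE]] := lipschitz_density m20 i2 yN.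
have yE t : 0 <= t -> x + (prim w t - prim w 0) = c t + F t.
  move=> t0; rewrite -(wE 0 t t0) !y_pos// F0 c0; ring.
exists w; split => //.
  by move=> t t0; rewrite yE//; have := cI t t0; clear; lra.
apply: ae_imply2 (prim_derive wi) (prim_derive fi) => t [dw dwE] [df dfE] t0.
have t0' := ltW t0.
rewrite yE//; have /andP[ct1 ct2] := cI t t0'.
have prim_diff r : t < r -> prim w r - prim w t = (c r - c t) + (F r - F t).
  move=> tr; rewrite -(wE t r (ltW tr)) !y_pos//; [ring|exact: le_trans t0' (ltW tr)].
apply: subdiff_chiI; first by apply/andP; clear -ct1 ct2; split; lra.
(* As [y t > -1], the lower obstacle stays below [c t] for a while; then [cA] with [M := c t] keeps
   [c] below [c t], so [y] grows no faster than [F] to the right of [t]. The other case is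
   symmetric. *)
- move=> yt; have [|d d0 Hd] := @continuous_gt _ F t (-1 - c t) cF.
    by clear -yt; lra.
  rewrite -dwE -dfE subr_ge0; apply: (derive1_le_right d0 dw df) => r tr rd.
  rewrite prim_diff// -FE -[leRHS]add0r lerD2r subr_le0.
  rewrite -[leRHS]maxxx; apply: cA => //; first exact: ltW.
  move=> q tq qr; have : -1 - c t < F q.
    by apply: Hd; rewrite ler0_norm; clear -tr rd tq qr; lra.
  by clear; lra.
- move=> yt; have cNF : continuous (fun q => - F q) by move=> q; apply: cvgN; exact: cF.
  have [|d d0 Hd] := @continuous_gt _ (fun q => - F q) t (c t - 1) cNF.
    by clear -yt; lra.
  rewrite -dwE -dfE subr_le0; apply: (derive1_le_right d0 df dw) => r tr rd.
  rewrite prim_diff// -FE -[leLHS]add0r lerD2r subr_ge0.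
  rewrite -[leLHS]minxx; apply: cB => //; first exact: ltW.
  move=> q tq qr; have : c t - 1 < - F q.
    by apply: Hd; rewrite ler0_norm; clear -tr rd tq qr; lra.
  by clear; lra.
Qed.

End Existence.

(** * Weak derivatives *)

Section SquareIntegrable.
Context d (T : measurableType d) (R : realType) (nu : {measure set T -> \bar R}).

Lemma Lfun2P (f : T -> R) : f \in Lfun nu 2%:E <->
  measurable_fun setT f /\ nu.-integrable setT (EFin \o (fun x => f x ^+ 2)).
Proof.
split => [fL|[mf fi]].
  split; last exact: Lfun2_integrable_sqr.
  by move: fL => /andP[/[!inE]/=].
rewrite inE; apply/andP; split; rewrite inE//=.
rewrite /finite_norm unlock /Lnorm poweR_lty//.
have /integrableP[_] := fi; congr (_ < _)%E; apply: eq_integral => x _ /=.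
by rewrite ger0_norm ?sqr_ge0// powR_mulrn// real_normK// num_real.
Qed.

End SquareIntegrable.

(** * Test functions of class C^1 with piecewise linear derivative *)

Section SmoothTest.
Context {R : realType}.
Notation mu := (@lebesgue_measure R).
Notation lam := (leb1 R).
Notation LR := (caratheodory_type (@wlength R idfun)^*%mu).

Lemma is_derive_mulr_norm (x : R) : is_derive x 1 (fun t : R => t * `|t|) (2 * `|x|).
Proof.
have [x0|x0|->] := ltgtP x 0.
- have dE : is_derive x 1 (fun t : R => - (t * t)) (2 * `|x|).
    apply: is_derive_eq; rewrite ltr0_norm// /GRing.scale/=; ring.
  apply: near_eq_is_derive dE.
  near=> t; rewrite ltr0_norm ?mulrN//; near: t; exact: lt_nbhsl.
- have dE : is_derive x 1 (fun t : R => t * t) (2 * `|x|).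
    apply: is_derive_eq; rewrite gtr0_norm// /GRing.scale/=; ring.
  apply: near_eq_is_derive dE.
  near=> t; rewrite gtr0_norm//; near: t; exact: lt_nbhsr.
- rewrite normr0 mulr0.
  have cv : h^-1 *: ((fun t : R => t * `|t|) (h *: 1 + 0) - (fun t : R => t * `|t|) 0)
      @[h --> 0^'] --> (0 : R).
    apply/cvgrPdist_lt => e e0; near=> h.
    have h0 : h != 0 by near: h; exact: nbhs_dnbhs_neq.
    rewrite addr0 mul0r subr0 sub0r normrN /GRing.scale/= mulr1 mulrA mulVf// mul1r normr_id.
    near: h; exact: dnbhs0_lt.
  apply: DeriveDef; last exact: cvg_lim.
  by apply/cvg_ex; exists 0.
Unshelve. all: by end_near. Qed.

Lemma continuous_FTC (phi : R -> R) (s t : R) : s <= t ->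
  (forall x, derivable phi x 1) -> continuous (derive1 phi) ->
  integr (derive1 phi) ->
  prim (derive1 phi) t - prim (derive1 phi) s = phi t - phi s.
Proof.
move=> st dphi cphi iphi; have [->|ts] := eqVneq s t; first by rewrite !subrr.
have {ts}st' : s < t by rewrite lt_neqAle ts.
rewrite prim_sub//; apply: EFin_inj.
have cont : continuous phi.
  by move=> x; apply: differentiable_continuous; exact/derivable1_diffP.
have c1 : {within `[s, t], continuous (derive1 phi)} by exact: continuous_subspaceT.
have c2 : derivable_oo_LRcontinuous phi s t.
  by split => //; [apply: cvg_at_right_filter; exact: cont|
                   apply: cvg_at_left_filter; exact: cont].
have c3 : {in `]s, t[, derive1 phi =1 derive1 phi} by [].
have mphi : measurable_fun `]s, t]%classic (fun x : R => (derive1 phi x)%:E).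
  by apply/measurable_EFinP; apply: measurable_funTS; exact: continuous_measurable_fun.
have H := continuous_FTC2 st' c1 c2 c3; rewrite -integral_itv_obnd_cbnd// in H.
apply: etrans (etrans H (esym (EFinB _ _))).
rewrite -integral_borel_leb1//.
by rewrite -[RHS](fineK (integrable_fin_num (leb1_measurable_itv _) (integr_itv _ iphi))).
Qed.

Lemma integr_indic (x y : R) (b c : bool) :
  integr (\1_[set` Interval (BSide b x) (BSide c y)] : R -> R).
Proof.
apply/integr_borelP; first exact: measurable_indic.
exact: integrable_indic_itv.
Qed.

Lemma compact_support_bounded (T : R) (h : R -> R) : 0 <= T -> continuous h ->
  (forall x, ~ (0 < x < T) -> h x = 0) -> exists C, forall x, `|h x| <= C.
Proof.
move=> T0 ch h0.
have [c _ Hc] : exists2 c, c \in `[0, T] & forall t, t \in `[0, T] -> `|h t| <= `|h c|.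
  apply: (@EVT_max R (fun x => `|h x|)) => //.
  by apply: continuous_subspaceT => x; apply: cvg_norm; exact: ch.
exists `|h c| => x; have [xT|xT] := boolP (x \in `[0, T]); first exact: Hc.
rewrite h0 ?normr0// => /andP[x0 x1]; move/negP: xT; apply.
by rewrite in_itv/= !ltW.
Qed.

Lemma compact_support_integr (T : R) (h : R -> R) : 0 <= T -> continuous h ->
  (forall x, ~ (0 < x < T) -> h x = 0) -> integr h.
Proof.
move=> T0 ch h0; have [C HC] := compact_support_bounded T0 ch h0.
apply: (@integr_le _ _ (fun x => C * \1_(`]0, T[ : set R) x)).
- exact: measurable_leb1_continuous.
- exact/integrZ/integr_indic.
- move=> x; rewrite indicE; have [xT|xT] := boolP (x \in _).
    by rewrite mulr1.
  rewrite h0 ?normr0 ?mulr0// => xx; move/negP: xT; apply.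
  by rewrite inE /= in_itv/=.
Qed.

Lemma is_derive_scale (q : R -> R) (dq : R -> R) (x c : R) (e : R) :
  (forall y : R, is_derive y 1 q (dq y)) -> e != 0 ->
  is_derive x 1 (fun y => q ((y - c) / e)) (dq ((x - c) / e) / e).
Proof.
move=> Hq e0.
have Hl : is_derive x 1 (fun y : R => (y - c) / e) e^-1.
  by apply: is_derive_eq; rewrite /GRing.scale/=; ring.
have := @is_derive1_comp R q (fun y => (y - c) / e) x (dq ((x - c) / e)) e^-1 (Hq _) Hl.
exact.
Qed.

(** A second difference of [x |x|], a C^1 primitive of [2 |x|]. It is a smoothed jump from -1/2 to
    1/2, constant outside [[-1, 1]], and its derivative [tent] is the hat function of mass 1. *)
Definition step (x : R) : R :=
  ((x + 1) * `|x + 1| + (x - 1) * `|x - 1| - 2 * (x * `|x|)) / 4.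

Definition tent (x : R) : R := (`|x + 1| + `|x - 1| - 2 * `|x|) / 2.

Lemma is_derive_step (x : R) : is_derive x 1 step (tent x).
Proof.
have sh (c : R) : is_derive x 1 (fun y : R => (y + c) * `|y + c|) (2 * `|x + c|).
  have := @is_derive1_comp R (fun t => t * `|t|) (fun y => y + c) x (2 * `|x + c|) 1
    (is_derive_mulr_norm _).
  by rewrite mulr1; apply; apply: is_derive_eq; rewrite addr0.
have h1 := sh 1; have h2 := sh (- 1); have h3 := is_derive_mulr_norm x.
rewrite /step; apply: is_derive_eq.
by rewrite /tent /GRing.scale/=; field.
Qed.

Lemma step_le (x : R) : x <= -1 -> step x = - (1 / 2).
Proof.
move=> x1; rewrite /step !ler0_norm; [by field|by lra|by lra|by lra].
Qed.

Lemma step_ge (x : R) : 1 <= x -> step x = 1 / 2.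
Proof.
move=> x1; rewrite /step !ger0_norm; [by field|by lra|by lra|by lra].
Qed.

Lemma tent_ge0 (x : R) : 0 <= tent x.
Proof.
rewrite /tent divr_ge0// subr_ge0 -[2 * _]ger0_norm ?mulr_ge0//.
rewrite normrM normr_id -normrM.
have -> : 2 * x = (x + 1) + (x - 1) by ring.
exact: ler_normD.
Qed.

Lemma tent_out (x : R) : 1 <= `|x| -> tent x = 0.
Proof.
rewrite /tent; have [x0 x1|x0 x1] := leP 0 x.
  rewrite ger0_norm in x1 => //.
  by rewrite !ger0_norm; [by field|by lra|by lra|by lra].
rewrite ltr0_norm in x1 => //.
by rewrite !ler0_norm; [by field|by lra|by lra|by lra].
Qed.

Lemma continuous_tent : continuous tent.
Proof.
move=> x; rewrite /tent; apply: cvgM; last exact: cvg_cst.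
have sh (c : R) : `|y + c| @[y --> x] --> `|x + c|.
  by apply: cvg_norm; apply: cvgD; [exact: cvg_id|exact: cvg_cst].
apply: cvgB; first by apply: cvgD; exact: sh.
by apply: cvgM; [exact: cvg_cst|apply: cvg_norm; exact: cvg_id].
Qed.

End SmoothTest.

(** * Weak derivatives on []0, T[] and primitives *)

Section WeakDerivative.
Context {R : realType}.
Notation mu := (@lebesgue_measure R).
Notation lam := (leb1 R).
Notation LR := (caratheodory_type (@wlength R idfun)^*%mu).
Variable T : R.
Hypothesis T0 : 0 < T.
Implicit Types (f g w : LR -> R) (y phi : R -> R) (C : R).

Notation I0T := (`]0, T[%classic : set R).

Lemma patchI f x : 0 < x < T -> (f \_ I0T) x = f x.
Proof. by move=> xT; rewrite patchE mem_set. Qed.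

Lemma patchO f x : ~ (0 < x < T) -> (f \_ I0T) x = 0.
Proof. by move=> xT; rewrite patchE memNset. Qed.

Lemma L2P f : L2 T f <-> measurable_fun (T := LR) setT (f \_ I0T) /\
  integr (fun x => (f \_ I0T) x ^+ 2).
Proof. by rewrite /L2 /=; rewrite Lfun2P; split=> -[? ?]; split => //; apply/integrP. Qed.

Lemma L2_integr f : L2 T f -> integr (f \_ I0T).
Proof.
move=> /L2P[mf f2]; apply: (@integr_le _ _ (fun x => (\1_I0T : R -> R) x + (f \_ I0T) x ^+ 2)) => //.
  by apply: integrD => //; exact: integr_indic.
move=> x; rewrite indicE; have [xT|xT] := pselect (0 < x < T).
  rewrite mem_set//; set v := (f \_ _) x.
  (* This square gives [|v| <= v ^+ 2 + 1 / 4], so the indicator and the square together dominate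
     [|v|]. *)
  have h : 0 <= (`|v| - 1 / 2) ^+ 2 by exact: sqr_ge0.
  rewrite -(real_normK (num_real v)) -[true%:R]/(1 : R).
  by move: (`|v|) h => r; clear; rewrite sqrrB; lra.
by rewrite patchO// normr0 expr0n/= addr0.
Qed.

Lemma L2_le f g C : L2 T f -> measurable_fun (T := LR) setT (g \_ I0T) ->
  (forall x, 0 < x < T -> `|g x| <= C * `|f x|) -> L2 T g.
Proof.
move=> /L2P[mf f2] mg gf; apply/L2P; split => //.
apply: (@integr_le _ _ (fun x => C ^+ 2 * (f \_ I0T) x ^+ 2)).
- exact: measurable_funX.
- exact: integrZ.
- move=> x; have [xT|xT] := pselect (0 < x < T); last by rewrite !patchO// expr0n/= normr0 mulr0.
  rewrite !patchI// normrX -(real_normK (num_real (f x))) -exprMn.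
  by apply: lerXn2r; rewrite ?nnegrE ?(le_trans _ (gf x xT))// gf.
Qed.

Lemma L2_bounded f C : measurable_fun (T := LR) setT (f \_ I0T) ->
  (forall x, 0 < x < T -> `|f x| <= C) -> L2 T f.
Proof.
move=> mf fC; apply/L2P; split => //.
apply: (@integr_le _ _ (fun x => C ^+ 2 * (\1_I0T : R -> R) x)).
- exact: measurable_funX.
- exact/integrZ/integr_indic.
- move=> x; rewrite indicE; have [xT|xT] := pselect (0 < x < T); last first.
    by rewrite patchO// expr0n/= normr0 memNset// mulr0.
  rewrite mem_set// patchI// mulr1 normrX.
  by apply: lerXn2r; rewrite ?nnegrE ?(le_trans _ (fC x xT))// fC.
Qed.

Lemma C1c_out phi x : C1c T phi -> ~ (0 < x < T) -> phi x = 0 /\ derive1 phi x = 0.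
Proof.
move=> [_ _ supp] xT.
have : ~ closure [set z | phi z != 0] x by move=> /supp /=; rewrite in_itv.
(* A point outside the closed support has a neighbourhood [B] on which [phi] vanishes, so its
   derivative vanishes there too. *)
move=> /existsNP[B /not_implyP[Bx]] Hdis.
have phi0 z : B z -> phi z = 0.
  by move=> Bz; apply: contrapT => /eqP pz; apply: Hdis; exists z.
split; first by apply: phi0; exact: nbhs_singleton.
rewrite derive1E (@near_eq_derive _ _ _ phi (cst 0)) ?derive_cst//.
by apply: filterS Bx => z /phi0.
Qed.

Lemma C1c_integr phi : C1c T phi -> integr (derive1 phi).
Proof.
move=> H; have [_ cphi _] := H.
by apply: (compact_support_integr (ltW T0)) => // x /(C1c_out H)[].
Qed.

Lemma C1c_prim phi t : C1c T phi ->
  phi t = - prim (derive1 phi) 0 + prim (derive1 phi) t.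
Proof.
move=> H; have [dphi cphi _] := H; have iphi := C1c_integr H.
have phi0 : phi 0 = 0 by apply: (C1c_out H _).1; rewrite ltxx.
have [t0|t0] := leP 0 t.
  have := continuous_FTC t0 dphi cphi iphi; rewrite phi0 subr0 => <-; ring.
have := continuous_FTC (ltW t0) dphi cphi iphi; rewrite phi0 sub0r.
by move=> /(congr1 -%R); rewrite opprK => <-; ring.
Qed.

(** [prim_sub] integrates over the half-open interval; [g] vanishes at [T], so the extra endpoint
    contributes nothing. *)
Lemma Rintegral_I0T (f g : R -> R) : integr g -> (forall x, 0 < x < T -> f x = g x) ->
  (forall x, ~ (0 < x < T) -> g x = 0) ->
  \int[lam]_(t in I0T) f t = prim g T - prim g 0.
Proof.
move=> gi fg g0; rewrite prim_sub ?(ltW T0)// Rintegral_mkcond [RHS]Rintegral_mkcond.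
apply: eq_Rintegral => x _; have [xT|xT] := pselect (0 < x < T).
  rewrite patchI// patchE mem_set ?fg//= in_itv/=.
  by case/andP: xT => -> /ltW ->.
by rewrite patchO// patchE g0//; case: ifP.
Qed.

(** By [C1c_prim] the test function is itself a primitive, so [prim_parts] applies to the product of
    [y] and [phi]; the boundary terms vanish with [phi]. *)
Lemma weak_derivative_prim y w (al : R) : L2 T w ->
  (forall t, 0 < t < T -> y t = al + prim (w \_ I0T) t) -> weak_derivative T y w.
Proof.
move=> wL2 yE; split => // phi Hphi.
have [dphi cphi supp] := Hphi.
have wi := L2_integr wL2; have iphi := C1c_integr Hphi.
have cont : continuous phi.
  by move=> x; apply: differentiable_continuous; exact/derivable1_diffP.
pose yy t := al + prim (w \_ I0T) t.
have cyy : continuous yy.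
  by move=> x; apply: cvgD; [exact: cvg_cst|exact: prim_continuous].
have i1 : integr (fun x => (w \_ I0T) x * phi x).
  apply: integrM_continuous => //; apply: (compact_support_bounded (ltW T0)) => //.
  by move=> x /(C1c_out Hphi)[].
have i2 : integr (fun x => derive1 phi x * yy x).
  apply: (compact_support_integr (ltW T0)).
    by move=> x; apply: cvgM; [exact: cphi|exact: cyy].
  by move=> x /(C1c_out Hphi)[_ ->]; rewrite mul0r.
have P := prim_parts al (- prim (derive1 phi) 0) wi iphi (ltW T0).
have phiE : (fun t => - prim (derive1 phi) 0 + prim (derive1 phi) t) = phi.
  by apply/funext => t; rewrite -C1c_prim.
have phiEt t : - prim (derive1 phi) 0 + prim (derive1 phi) t = phi t.
  by rewrite -C1c_prim.
rewrite !phiEt in P.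
have out0 : ~ (0 < (0 : R) < T) by move=> /andP[]; rewrite ltxx.
have outT : ~ (0 < T < T) by move=> /andP[_]; rewrite ltxx.
rewrite (C1c_out Hphi out0).1 (C1c_out Hphi outT).1 !mulr0 subrr in P.
rewrite (_ : (fun x : LR => _) = fun x => (w \_ I0T) x * phi x + derive1 phi x * yy x) in P; last first.
  by apply/funext => x; rewrite phiEt.
rewrite !primD// in P.
rewrite (@Rintegral_I0T _ (fun x => derive1 phi x * yy x))//; last 2 first.
- by move=> x xT; rewrite yE// mulrC.
- by move=> x /(C1c_out Hphi)[_ ->]; rewrite mul0r.
rewrite (@Rintegral_I0T _ (fun x => (w \_ I0T) x * phi x))//; last 2 first.
- by move=> x xT; rewrite patchI.
- by move=> x xT; rewrite patchO// mul0r.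
move: P; clear; lra.
Qed.

(** The constant extension turns continuity relative to [[0, T]] into continuity on the line, the
    form used by [weak_constant]. *)
Lemma clamp_continuous y : {within `[0, T], continuous y} ->
  continuous (fun t : R => y (Num.max 0 (Num.min t T))).
Proof.
move=> cy x; pose c (t : R) := Num.max 0 (Num.min t T).
have cI t : `[0, T]%classic (c t).
  by rewrite /c /= in_itv/= le_max lexx/= ge_max (ltW T0) ge_min lexx orbT.
have cc : continuous c.
  move=> t; apply: (@continuous_max _ _ (cst 0) (fun t => Num.min t T)).
    exact: cvg_cst.
  apply: (@continuous_min _ _ id (cst T)); [exact: cvg_id|exact: cvg_cst].
have H : y @ within `[0, T]%classic (nbhs (c x)) --> nbhs (y (c x)).
  by rewrite (nbhs_subspace_in (cI x)); exact: cy.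
apply/cvgrPdist_lt => e e0; have /cvgrPdist_lt/(_ e e0) He := H.
have := cc x _ He; rewrite /nbhs /= => -[d d0 Hd].
by exists d => // t xt; have := Hd t xt; apply; exact: cI.
Qed.

Lemma continuous_tent_scale (c e : R) : continuous (fun x => tent ((x - c) / e) / e).
Proof.
move=> x; apply: cvgM; last exact: cvg_cst.
have Hl : {for x, continuous (fun x : R => (x - c) / e)}.
  by apply: cvgM; [apply: cvgB; [exact: cvg_id|exact: cvg_cst]|exact: cvg_cst].
exact: (continuous_comp Hl (@continuous_tent R _)).
Qed.

Lemma C1c_bump s t e : 0 < e -> 0 < s - e -> s + e < T -> 0 < t - e -> t + e < T ->
  C1c T (fun x => step ((x - s) / e) - step ((x - t) / e)) /\
  forall x, derive1 (fun x => step ((x - s) / e) - step ((x - t) / e)) x =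
    tent ((x - s) / e) / e - tent ((x - t) / e) / e.
Proof.
move=> e0 s1 s2 t1 t2; have ene : e != 0 by rewrite gt_eqF.
have dE (x : R) : is_derive x 1 (fun x => step ((x - s) / e) - step ((x - t) / e))
    (tent ((x - s) / e) / e - tent ((x - t) / e) / e).
  have h1 := is_derive_scale x s is_derive_step ene.
  have h2 := is_derive_scale x t is_derive_step ene.
  exact: is_deriveB.
have ct (c : R) := @continuous_tent_scale c e.
have d1E x : derive1 (fun x => step ((x - s) / e) - step ((x - t) / e)) x =
    tent ((x - s) / e) / e - tent ((x - t) / e) / e.
  by rewrite derive1E; exact: derive_val.
split => //; split.
- by move=> x; have [] := dE x.
- rewrite (_ : derive1 _ = fun x => tent ((x - s) / e) / e - tent ((x - t) / e) / e).
    by move=> x; apply: cvgB; exact: ct.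
  by apply/funext => x; exact: d1E.
(* To the left of [l] and to the right of [r] both steps have reached the same constant and
   cancel. *)
- pose l := Num.min s t - e; pose r := Num.max s t + e.
  have sub : [set x | step ((x - s) / e) - step ((x - t) / e) != 0] `<=` `[l, r].
    move=> x /=; apply: contraR; rewrite in_itv/= negb_and -!ltNge.
    move=> /orP[xl|xr].
      have [xs xt] : x < s - e /\ x < t - e.
        by move: xl; rewrite /l ltrBrDr lt_min => /andP[? ?]; split; lra.
      by rewrite !step_le ?subrr// ler_pdivrMr//; lra.
    have [xs xt] : s + e < x /\ t + e < x.
      by move: xr; rewrite /r -ltrBrDr gt_max => /andP[? ?]; split; lra.
    by rewrite !step_ge ?subrr// ler_pdivlMr//; lra.
  apply: subset_trans (closure_subset sub) _.
  rewrite -(closure_id _).1; last exact: itv_closed.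
  move=> x /=; rewrite !in_itv/= => /andP[lx xr]; apply/andP; split.
    by apply: lt_le_trans lx; rewrite /l subr_gt0 lt_min; apply/andP; split; lra.
  by apply: le_lt_trans xr _; rewrite /r -ltrBrDr gt_max; apply/andP; split; lra.
Qed.

(* du Bois-Reymond: test against a step up at [s] followed by a step down at
   [t]. *)
Lemma weak_constant (z : R -> R) : continuous z ->
  (forall phi, C1c T phi -> prim (fun x => z x * derive1 phi x) T -
     prim (fun x => z x * derive1 phi x) 0 = 0) ->
  forall s t, 0 < s < T -> 0 < t < T -> z s <= z t.
Proof.
move=> cz Hz s t /andP[s0 sT] /andP[t0 tT]; rewrite leNgt; apply/negP => zts.
(* Assuming [z t < z s], [m] is the midpoint and [ka] a quarter of the gap, so that [z > m + ka]
   near [s] and [z < m - ka] near [t]. *)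
pose m := (z s + z t) / 2; pose ka := (z s - z t) / 4.
have ka0 : 0 < ka by rewrite /ka; lra.
have [|d1 d10 H1] := @continuous_gt _ z s (m + ka) cz; first by rewrite /m /ka; lra.
have cNz : continuous (fun q => - z q) by move=> q; apply: cvgN; exact: cz.
have [|d2 d20 H2] := @continuous_gt _ (fun q => - z q) t (ka - m) cNz.
  by rewrite /m /ka; lra.
(* Small enough for both hats to lie in []0, T[] and in the neighbourhoods just found. *)
pose e := Num.min (Num.min d1 d2) (Num.min (Num.min (s / 2) (t / 2))
  (Num.min ((T - s) / 2) ((T - t) / 2))).
have [e0 [[ed1 ed2] [[es et] [eTs eTt]]]] : 0 < e /\ ((e <= d1 /\ e <= d2) /\
    ((e <= s / 2 /\ e <= t / 2) /\ (e <= (T - s) / 2 /\ e <= (T - t) / 2))).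
  split; first by rewrite /e !lt_min d10 d20 !divr_gt0// subr_gt0.
  by rewrite /e !ge_min !lexx ?orbT.
have [||||Hphi dphiE] := @C1c_bump s t e e0; [clear -s0 es e0; lra|
  clear -sT eTs e0; lra|clear -t0 et e0; lra|clear -tT eTt e0; lra|].
set phi := (fun x => step ((x - s) / e) - step ((x - t) / e)) in Hphi dphiE.
pose psi (c x : R) := tent ((x - c) / e) / e.
have psi0 c x : 0 <= psi c x by rewrite divr_ge0 ?tent_ge0// ltW.
have psi_out c x : e <= `|c - x| -> psi c x = 0.
  move=> xc; rewrite /psi tent_out ?mul0r// normrM normfV (gtr0_norm e0).
  by rewrite ler_pdivlMr// mul1r distrC.
have cpsi c : continuous (psi c) := @continuous_tent_scale c e.
have dpsi c (x : R) : is_derive x 1 (fun x => step ((x - c) / e)) (psi c x).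
  by apply: (is_derive_scale x c is_derive_step); rewrite gt_eqF.
have psiE c : derive1 (fun x => step ((x - c) / e)) = psi c.
  by apply/funext => x; rewrite derive1E; exact: derive_val.
have ipsi c : e <= c / 2 -> e <= (T - c) / 2 -> integr (psi c).
  move=> ec eTc; apply: (compact_support_integr (ltW T0) (cpsi c)) => x xT.
  apply: psi_out; have [cx|xc] := leP x c.
    rewrite ger0_norm ?subr_ge0//; have [x0|x0] := leP x 0; first by clear -ec x0 e0; lra.
    have [Tx|Tx] := leP T x; first by clear -Tx cx eTc e0; lra.
    by case: xT; apply/andP; split.
  rewrite ltr0_norm ?subr_lt0//; have [x0|x0] := leP x 0; first by clear -ec x0 xc e0; lra.
  have [Tx|Tx] := leP T x; first by clear -Tx eTc e0; lra.
  by case: xT; apply/andP; split.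
have is_ := ipsi s es eTs.
have iphi := C1c_integr Hphi.
have int_psi : prim (psi s) T - prim (psi s) 0 = 1.
  have dst (x : R) : derivable (fun x => step ((x - s) / e)) x 1 by have [] := dpsi s x.
  have := @continuous_FTC R (fun x => step ((x - s) / e)) 0 T (ltW T0) dst.
  rewrite psiE => -> //.
  rewrite step_ge; last by rewrite ler_pdivlMr//; clear -eTs e0; lra.
  rewrite step_le; last by rewrite ler_pdivrMr//; clear -es e0; lra.
  by field.
have int_phi : prim (derive1 phi) T - prim (derive1 phi) 0 = 0.
  have [dphi cphi _] := Hphi.
  rewrite (continuous_FTC (ltW T0) dphi cphi iphi).
  rewrite (C1c_out Hphi _).1; last by move=> /andP[_]; rewrite ltxx.
  by rewrite (C1c_out Hphi _).1 ?subrr// => /andP[]; rewrite ltxx.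
have := Hz phi Hphi.
have izphi : integr (fun x => z x * derive1 phi x).
  have [_ cphi _] := Hphi; apply: (compact_support_integr (ltW T0)).
    by move=> x; apply: cvgM; [exact: cz|exact: cphi].
  by move=> x /(C1c_out Hphi)[_ ->]; rewrite mulr0.
have i2 : integr (fun x => m * derive1 phi x + ka * psi s x).
  by apply: integrD; exact: integrZ.
(* The derivative of [phi] is [psi s - psi t]. It integrates to 0 and [psi s] to 1, so the left side
   equals [ka > 0], while the right side is 0 by hypothesis. *)
have : prim (fun x => m * derive1 phi x + ka * psi s x) T -
    prim (fun x => m * derive1 phi x + ka * psi s x) 0 <=
    prim (fun x => z x * derive1 phi x) T - prim (fun x => z x * derive1 phi x) 0.
  apply: (prim_le i2 izphi (ltW T0)) => x _.
  rewrite dphiE -/(psi s x) -/(psi t x).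
  have h1 : ka * psi s x <= (z x - m) * psi s x.
    have [xs|xs] := leP e `|s - x|; first by rewrite psi_out// !mulr0.
    by rewrite ler_wpM2r// ltW//; have := H1 x (lt_le_trans xs ed1); clear; lra.
  have h2 : (z x - m) * psi t x <= 0.
    have [xt|xt] := leP e `|t - x|; first by rewrite psi_out// mulr0.
    rewrite mulr_le0_ge0// ltW//; have := H2 x (lt_le_trans xt ed2).
    by clear -ka0; lra.
  by move: h1 h2; clear; lra.
rewrite !primD ?primZ//; try exact: integrZ.
move: int_psi int_phi ka0; clear; nra.
Qed.

(** Both [y] and the primitive of [w] have weak derivative [w], so their difference [z] is constant
    inside by [weak_constant], and up to the endpoints by continuity. *)
Lemma weak_derivative_ac y w : {within `[0, T], continuous y} ->
  weak_derivative T y w -> forall t, 0 <= t <= T ->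
  y t = y 0 + (prim (w \_ I0T) t - prim (w \_ I0T) 0).
Proof.
move=> cy [wL2 wE].
have wi := L2_integr wL2.
pose c (t : R) := Num.max 0 (Num.min t T).
have cE t : 0 <= t <= T -> c t = t.
  by move=> /andP[t0 tT]; rewrite /c min_l// max_r.
pose z t := y (c t) - prim (w \_ I0T) t.
have cyc : continuous (fun t => y (c t)) by exact: clamp_continuous.
have cz : continuous z.
  by move=> x; apply: cvgB; [exact: cyc|exact: prim_continuous].
have z0 phi : C1c T phi -> prim (fun x => z x * derive1 phi x) T -
     prim (fun x => z x * derive1 phi x) 0 = 0.
  move=> Hphi; have [_ cphi _] := Hphi.
  have [|_ /(_ phi Hphi)] := @weak_derivative_prim (prim (w \_ I0T)) w 0 wL2.
    by move=> t _; rewrite add0r.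
  have i1 : integr (fun x => prim (w \_ I0T) x * derive1 phi x).
    apply: (compact_support_integr (ltW T0)).
      by move=> x; apply: cvgM; [exact: prim_continuous|exact: cphi].
    by move=> x /(C1c_out Hphi)[_ ->]; rewrite mulr0.
  have i2 : integr (fun x => y (c x) * derive1 phi x).
    apply: (compact_support_integr (ltW T0)).
      by move=> x; apply: cvgM; [exact: cyc|exact: cphi].
    by move=> x /(C1c_out Hphi)[_ ->]; rewrite mulr0.
  rewrite -(wE phi Hphi) (Rintegral_I0T i1)//; last first.
    by move=> x /(C1c_out Hphi)[_ ->]; rewrite mulr0.
  rewrite (Rintegral_I0T i2); last 2 first.
  - by move=> x /andP[x0 xT]; rewrite cE// !ltW.
  - by move=> x /(C1c_out Hphi)[_ ->]; rewrite mulr0.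
  rewrite (_ : (fun x : LR => z x * _) = fun x => y (c x) * derive1 phi x -
    prim (w \_ I0T) x * derive1 phi x); last by apply/funext => x; rewrite /z mulrBl.
  rewrite !primB//; clear; lra.
(* The points of []0, T[] are dense in [[0, T]]: move from [x] towards the far end by at most a
   quarter of [T]. *)
have near_in x d : 0 <= x <= T -> 0 < d -> exists2 r, 0 < r < T & `|x - r| < d.
  move=> /andP[x0 xT] d0; have [xh|xh] := leP x (T / 2).
    exists (x + Num.min (d / 2) (T / 4)).
      have : Num.min (d / 2) (T / 4) <= T / 4 by rewrite ge_min lexx orbT.
      have : 0 < Num.min (d / 2) (T / 4) by rewrite lt_min !divr_gt0.
      by clear -x0 xh T0; move=> ? ?; apply/andP; split; lra.
    have : Num.min (d / 2) (T / 4) <= d / 2 by rewrite ge_min lexx.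
    have h : 0 < Num.min (d / 2) (T / 4) by rewrite lt_min !divr_gt0.
    rewrite opprD addNKr normrN gtr0_norm//; clear -d0; lra.
  exists (x - Num.min (d / 2) (T / 4)).
    have : Num.min (d / 2) (T / 4) <= T / 4 by rewrite ge_min lexx orbT.
    have : 0 < Num.min (d / 2) (T / 4) by rewrite lt_min !divr_gt0.
    by clear -xT xh T0; move=> ? ?; apply/andP; split; lra.
  have : Num.min (d / 2) (T / 4) <= d / 2 by rewrite ge_min lexx.
  have h : 0 < Num.min (d / 2) (T / 4) by rewrite lt_min !divr_gt0.
  rewrite opprB addrCA subrr addr0 gtr0_norm//; clear -d0; lra.
have zle x r : 0 <= x <= T -> 0 <= r <= T -> z x <= z r.
  move=> xT rT; rewrite leNgt; apply/negP => zrx.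
  have [|d1 d10 H1] := @continuous_gt _ z x ((z x + z r) / 2) cz; first by clear -zrx; lra.
  have cNz : continuous (fun q => - z q) by move=> q; apply: cvgN; exact: cz.
  have [|d2 d20 H2] := @continuous_gt _ (fun q => - z q) r (- ((z x + z r) / 2)) cNz.
    by clear -zrx; lra.
  have [x' x'T /H1] := near_in x d1 xT d10; have [r' r'T /H2] := near_in r d2 rT d20.
  by have := weak_constant cz z0 x'T r'T; clear; lra.
move=> t tT; have zT : 0 <= (0 : R) <= T by rewrite lexx ltW.
have : z t = z 0 by apply/eqP; rewrite eq_le !zle.
rewrite /z !cE//; clear; lra.
Qed.

End WeakDerivative.

(** * The dynamic relay *)

Section RelayFunction.
Context {R : realType}.
Variable k : R.
Hypothesis k0 : 0 < k.
Implicit Types (rho : R * R) (s t : R).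

Lemma pos_part_lip (a b : R) : `|Num.max a 0 - Num.max b 0| <= `|a - b|.
Proof.
have [a0|a0] := leP a 0; have [b0|b0] := leP b 0; rewrite ?subrr ?normr0//.
- by rewrite sub0r normrN (gtr0_norm b0) ltr0_norm; lra.
- by rewrite subr0 (gtr0_norm a0) ger0_norm; lra.
Qed.

Lemma g_mono rho s t : s <= t -> g k rho s <= g k rho t.
Proof.
move=> st; rewrite /g /neg_part /pos_part; apply: lerD.
  rewrite lerN2 ler_pM2l// ge_max !le_max lexx orbT andbT.
  by apply/orP; left; lra.
rewrite ler_pM2l// ge_max !le_max lexx orbT andbT.
by apply/orP; left; lra.
Qed.

(** The condition [rho.1 <= rho.2] keeps the two sloped pieces of [g] from overlapping; otherwise
    the slope would be [2 k] between the thresholds. The sharp constant is the [k] of the Lipschitz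
    estimate. *)
Lemma g_lip rho s t : rho.1 <= rho.2 -> `|g k rho s - g k rho t| <= k * `|s - t|.
Proof.
move=> rr; wlog st : s t / s <= t.
  move=> H; have [|/ltW] := leP s t; first exact: H.
  by move=> /H; rewrite distrC (distrC t).
rewrite distrC (distrC s) ger0_norm ?subr_ge0 ?g_mono// ger0_norm ?subr_ge0//.
rewrite -(ler_pM2l (x := k^-1)) ?invr_gt0// mulKf ?gt_eqF//.
have -> : k^-1 * (g k rho t - g k rho s) = Num.max (- (s - rho.1)) 0 - Num.max (- (t - rho.1)) 0
    + (Num.max (t - rho.2) 0 - Num.max (s - rho.2) 0).
  by rewrite /g /neg_part /pos_part; field; rewrite gt_eqF.
case: (leP (- (s - rho.1)) 0); case: (leP (- (t - rho.1)) 0);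
  case: (leP (t - rho.2) 0); case: (leP (s - rho.2) 0); lra.
Qed.

Lemma g_lip_rho rho rho' s :
  `|g k rho s - g k rho' s| <= k * (`|rho.1 - rho'.1| + `|rho.2 - rho'.2|).
Proof.
have -> : g k rho s - g k rho' s =
    k * ((Num.max (- (s - rho'.1)) 0 - Num.max (- (s - rho.1)) 0) +
         (Num.max (s - rho.2) 0 - Num.max (s - rho'.2) 0)).
  by rewrite /g /neg_part /pos_part; ring.
rewrite normrM gtr0_norm// ler_pM2l//; apply: le_trans (ler_normD _ _) _.
apply: lerD; apply: le_trans (pos_part_lip _ _) _.
  by rewrite distrC le_eqVlt; apply/orP; left; apply/eqP; congr `|_|; ring.
by rewrite distrC le_eqVlt; apply/orP; left; apply/eqP; congr `|_|; ring.
Qed.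

Lemma g_bound rho s : `|g k rho s| <= k * (2 * `|s| + `|rho.1| + `|rho.2|).
Proof.
have -> : g k rho s = k * (Num.max (s - rho.2) 0 - Num.max (- (s - rho.1)) 0).
  by rewrite /g /neg_part /pos_part; ring.
rewrite normrM gtr0_norm// ler_pM2l//; apply: le_trans (ler_normB _ _) _.
have maxn (a : R) : `|Num.max a 0| <= `|a|.
  by have := pos_part_lip a 0; rewrite maxxx !subr0.
have := maxn (s - rho.2); have := maxn (- (s - rho.1)); rewrite normrN.
have := ler_normB s rho.1; have := ler_normB s rho.2; lra.
Qed.

Lemma continuous_g rho : continuous (g k rho).
Proof.
move=> s; rewrite /g /neg_part /pos_part.
have cm (h : R -> R) : continuous h -> continuous (fun t => k * Num.max (h t) 0).
  move=> ch t; apply: cvgM; first exact: cvg_cst.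
  by apply: (@continuous_max _ _ h (cst 0)); [exact: ch|exact: cvg_cst].
apply: cvgD; last first.
  by apply: (cm (fun t => t - rho.2)) => t; apply: cvgB; [exact: cvg_id|exact: cvg_cst].
apply: cvgN; apply: (cm (fun t => - (t - rho.1))) => t.
by apply: cvgN; apply: cvgB; [exact: cvg_id|exact: cvg_cst].
Qed.

End RelayFunction.

(** * Solutions of the relay inclusion and their dependence on the data *)

Section RelaySolution.
Context {R : realType}.
Notation mu := (@lebesgue_measure R).
Notation lam := (leb1 R).
Notation LR := (caratheodory_type (@wlength R idfun)^*%mu).
Variables (T k : R).
Hypotheses (T0 : 0 < T) (k0 : 0 < k).
Implicit Types (u : R -> R) (rho : R * R) (x : R).

Notation I0T := (`]0, T[%classic : set R).

Definition forcing rho u : R -> R := (fun t => g k rho (u t)) \_ I0T.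

Lemma forcingI rho u t : 0 < t < T -> forcing rho u t = g k rho (u t).
Proof. exact: patchI. Qed.

Lemma forcing_L2 rho u : L2 T u -> L2 T (fun t => g k rho (u t)).
Proof.
move=> uL2; have ui := L2_integr uL2.
have /L2P[mu_ u2] := uL2; apply/L2P.
have m : measurable_fun (T := LR) setT (forcing rho u).
  rewrite (_ : forcing rho u = fun t => g k rho ((u \_ I0T) t) * (\1_I0T : R -> R) t).
    apply: measurable_funM; last exact: integr_meas (integr_indic _ _ _ _).
    apply: (measurableT_comp _ mu_).
    by apply: continuous_measurable_fun; exact: continuous_g.
  apply/funext => t; rewrite indicE; have [tT|tT] := pselect (0 < t < T).
    by rewrite forcingI// patchI// mem_set// mulr1.
  by rewrite /forcing patchO// memNset// mulr0.
split => //.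
pose c := `|rho.1| + `|rho.2|.
(* The constants come from [(a + b) ^+ 2 <= 2 a ^+ 2 + 2 b ^+ 2] with [a = 2 k |u|] and
   [b = k c]. *)
apply: (@integr_le _ _ (fun t => 8 * k ^+ 2 * (u \_ I0T) t ^+ 2 +
    2 * k ^+ 2 * c ^+ 2 * (\1_I0T : R -> R) t)).
- exact: measurable_funX.
- by apply: integrD; apply: integrZ => //; exact: integr_indic.
- move=> t; rewrite indicE; have [tT|tT] := pselect (0 < t < T); last first.
    by rewrite !patchO// memNset// !expr0n/= !mulr0 addr0 normr0.
  rewrite !patchI// mem_set// mulr1 normrX.
  apply: (@le_trans _ _ ((k * (2 * `|u t| + c)) ^+ 2)).
    apply: lerXn2r; rewrite ?nnegrE//.
      by rewrite mulr_ge0 ?(ltW k0)// addr_ge0// ?mulr_ge0// addr_ge0.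
    by rewrite /c addrA; exact: g_bound.
  rewrite -(real_normK (num_real (u t))).
  have : 0 <= k ^+ 2 * (2 * `|u t| - c) ^+ 2 by rewrite mulr_ge0 ?sqr_ge0.
  rewrite -subr_ge0; move=> h; rewrite -subr_ge0.
  by move: h; rewrite !subr0; move: (`|u t|) => v; clear; nra.
Qed.

Lemma forcing_integr rho u : L2 T u -> integr (forcing rho u).
Proof. by move=> uL2; exact: (L2_integr (forcing_L2 rho uL2)). Qed.

(** Translates the weak formulation into the primitive form on which the comparison principle
    operates. *)
Lemma relay_ac rho u x y : relay_solution T k rho u x y ->
  exists w, [/\ integr w,
    forall t, 0 <= t <= T -> y t = x + (prim w t - prim w 0),
    forall t, 0 <= t <= T -> -1 <= y t <= 1 &
    {ae lam, forall t, 0 < t < T ->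
      subdiff_chi (x + (prim w t - prim w 0)) (forcing rho u t - w t)}].
Proof.
move=> [[cy yL2 _] y1 y0x [w wy inc]]; exists (w \_ I0T).
have yE t : 0 <= t <= T -> y t = x + (prim (w \_ I0T) t - prim (w \_ I0T) 0).
  by move=> tT; rewrite -y0x; exact: (weak_derivative_ac T0).
split => //; first exact: (L2_integr wy.1).
apply: ae_imply inc => t H tT; have [t0 tT'] := andP tT.
rewrite -yE ?ltW// forcingI// patchI//; apply: H; by rewrite in_itv.
Qed.

Lemma relay_compare rho1 rho2 u1 u2 x1 x2 y1 y2 (G : R -> R) :
  relay_solution T k rho1 u1 x1 y1 -> relay_solution T k rho2 u2 x2 y2 ->
  integr G -> (forall t, 0 <= G t) ->
  {ae lam, forall t, 0 < t < T -> g k rho1 (u1 t) - g k rho2 (u2 t) <= G t} ->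
  forall t, 0 <= t <= T ->
    y1 t - y2 t <= Num.max (x1 - x2) 0 + (prim G t - prim G 0).
Proof.
move=> /relay_ac[w1 [w1i y1E _ inc1]] /relay_ac[w2 [w2i y2E _ inc2]] Gi G0 HG t tT.
rewrite y1E// y2E//; apply: (inclusion_compare w1i w2i Gi G0 inc1 inc2 _ tT).
by apply: ae_imply HG => r H rT; rewrite !forcingI//; exact: H.
Qed.

Lemma relay_exists rho u x : L2 T u -> -1 <= x <= 1 ->
  exists w, [/\ integr w, forall t, `|w t| <= 2 * `|forcing rho u t| &
    relay_solution T k rho u x (fun t => x + (prim w t - prim w 0))].
Proof.
move=> uL2 x1; have fi := forcing_integr rho uL2.
have [w [wi wf y1 inc]] := stop_exists fi x1.
exists w; split => //.
(* The bound by [forcing], which is zero off []0, T[], makes [w] its own extension by zero. *)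
have wE : w \_ I0T = w.
  apply/funext => t; have [tT|tT] := pselect (0 < t < T); first by rewrite patchI.
  rewrite patchO//; have := wf t.
  by rewrite /forcing patchO// normr0 mulr0 normr_le0 => /eqP.
have wL2 : L2 T w.
  apply: (L2_le (forcing_L2 rho uL2) (C := 2)); first by rewrite wE; exact: integr_meas.
  by move=> t tT; have := wf t; rewrite forcingI.
pose y t := x + (prim w t - prim w 0).
have cy : continuous y.
  move=> t; apply: cvgD; first exact: cvg_cst.
  by apply: cvgB; [exact: prim_continuous|exact: cvg_cst].
have wy : weak_derivative T y w.
  apply: (weak_derivative_prim T0 wL2 (al := x - prim w 0)) => t tT.
  by rewrite wE /y; ring.
split.
- split; last by exists w.
    exact: continuous_subspaceT.
  apply: (L2_bounded (C := 1)).
    rewrite (_ : _ \_ _ = fun t => y t * (\1_I0T : R -> R) t).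
      apply: measurable_funM; last exact: integr_meas (integr_indic _ _ _ _).
      exact: measurable_leb1_continuous.
    apply/funext => t; rewrite indicE; have [tT|tT] := pselect (0 < t < T).
      by rewrite patchI// mem_set// mulr1.
    by rewrite patchO// memNset// mulr0.
  by move=> t /andP[t0 _]; rewrite ler_norml; apply: y1; exact: ltW.
- by move=> t; rewrite in_itv/= => /andP[t0 _]; exact: y1.
- by rewrite subrr addr0.
- exists w => //; apply: ae_imply inc => t H; rewrite in_itv/= => tT.
  by rewrite -forcingI//; apply: H; case/andP: tT.
Qed.

Lemma etaP rho u x : L2 T u -> -1 <= x <= 1 ->
  relay_solution T k rho u x (eta T k rho u x).
Proof.
move=> uL2 x1; have [w [_ _ H]] := relay_exists rho uL2 x1.
by apply: xgetPex; exists (fun t => x + (prim w t - prim w 0)).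
Qed.

Lemma eta_out rho u x : ~ (-1 <= x <= 1) -> eta T k rho u x = fun=> 0.
Proof.
move=> x1; apply: xgetPN => y [_ y1 y0 _]; apply: x1; rewrite -y0; apply: y1.
by rewrite in_itv/= lexx ltW.
Qed.

Lemma eta_bound rho u x t : L2 T u -> 0 <= t <= T -> `|eta T k rho u x t| <= 1.
Proof.
move=> uL2 tT; have [x1|x1] := pselect (-1 <= x <= 1); last first.
  by rewrite eta_out// normr0.
by have [_ H _ _] := etaP rho uL2 x1; rewrite ler_norml; apply: H; rewrite in_itv.
Qed.

Lemma eta_lip rho1 rho2 u1 u2 x1 x2 (G : R -> R) : L2 T u1 -> L2 T u2 ->
  -1 <= x1 <= 1 -> -1 <= x2 <= 1 -> integr G -> (forall t, 0 <= G t) ->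
  {ae lam, forall t, 0 < t < T -> `|g k rho1 (u1 t) - g k rho2 (u2 t)| <= G t} ->
  forall t, 0 <= t <= T ->
    `|eta T k rho1 u1 x1 t - eta T k rho2 u2 x2 t| <=
      `|x1 - x2| + (prim G t - prim G 0).
Proof.
move=> u1L2 u2L2 x11 x21 Gi G0 HG t tT.
have e1 := etaP rho1 u1L2 x11; have e2 := etaP rho2 u2L2 x21.
have maxle (a : R) : Num.max a 0 <= `|a| by rewrite ge_max ler_norm normr_ge0.
rewrite ler_norml; apply/andP; split.
  have H : {ae lam, forall t, 0 < t < T -> g k rho2 (u2 t) - g k rho1 (u1 t) <= G t}.
    apply: ae_imply HG => r H rT; apply: le_trans (H rT).
    by rewrite distrC ler_norm.
  have := relay_compare e2 e1 Gi G0 H tT; have := maxle (x2 - x1); rewrite distrC.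
  by clear; lra.
have H : {ae lam, forall t, 0 < t < T -> g k rho1 (u1 t) - g k rho2 (u2 t) <= G t}.
  by apply: ae_imply HG => r H rT; apply: le_trans (H rT); exact: ler_norm.
by have := relay_compare e1 e2 Gi G0 H tT; have := maxle (x1 - x2); clear; lra.
Qed.

(** Comparison with zero forcing bound, in both directions, identifies [eta] with the solution
    constructed in [relay_exists]; the factor 2 is the one in its bound on [w]. *)
Lemma eta_time rho u x s t (G : R -> R) : L2 T u -> integr G ->
  (forall r, 0 < r < T -> 2 * `|g k rho (u r)| <= G r) -> (forall r, 0 <= G r) ->
  0 <= s -> s <= t -> t <= T ->
  `|eta T k rho u x t - eta T k rho u x s| <= prim G t - prim G s.
Proof.
move=> uL2 Gi fG G0 s0 st tT.
have [x1|x1] := pselect (-1 <= x <= 1); last first.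
  by rewrite eta_out// subrr normr0 subr_ge0; exact: prim_mono.
have [w [wi wf sol]] := relay_exists rho uL2 x1.
have i0 : integr (fun=> 0 : R).
  apply: (@integr_le _ _ (fun x => `|w x|)) => //; first exact: integr_norm.
  by move=> r; rewrite normr0.
have prim0 r : prim (fun=> 0 : R) r - prim (fun=> 0 : R) 0 = 0.
  have -> : (fun=> 0) = (fun r : LR => 0 * w r) by apply/funext => q; rewrite mul0r.
  by rewrite !primZ// !mul0r subrr.
have uniq r : 0 <= r <= T -> eta T k rho u x r = x + (prim w r - prim w 0).
  move=> rT; apply/eqP; rewrite eq_le; apply/andP; split; rewrite -subr_le0.
    have := relay_compare (etaP rho uL2 x1) sol i0 (fun=> lexx _) _ rT.
    rewrite prim0 addr0 subrr maxxx; apply.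
    by apply: ae_borel_leb1; apply: aeW => /= q _; rewrite subrr.
  have := relay_compare sol (etaP rho uL2 x1) i0 (fun=> lexx _) _ rT.
  rewrite prim0 addr0 subrr maxxx; apply.
  by apply: ae_borel_leb1; apply: aeW => /= q _; rewrite subrr.
rewrite !uniq; [|by rewrite s0 (le_trans st)|by rewrite (le_trans s0)].
have -> : x + (prim w t - prim w 0) - (x + (prim w s - prim w 0)) = prim w t - prim w s by ring.
apply: le_trans (prim_norm wi st) _; apply: prim_le => //; first exact: integr_norm.
move=> r _; apply: le_trans (wf r) _.
have [rT|rT] := pselect (0 < r < T); first by rewrite forcingI//; exact: fG.
by rewrite /forcing patchO// normr0 mulr0.
Qed.

End RelaySolution.

(** * Measurability from Lipschitz dependence and integrability of bounded factors *)

Section BoundedFactors.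
Context d (X : measurableType d) (R : realType) (nu : {measure set X -> \bar R}).

Lemma measurable_fun_norm (D : set X) (h : X -> R) : measurable_fun D h ->
  measurable_fun D (fun x => `|h x|).
Proof. by move=> mh; apply: measurableT_comp. Qed.

(* [Phi (h x) < r] iff [Phi q + K * dist q (h x) < r] for some rational point
   [q]. *)
Lemma lipschitz3_measurable (D : set X) (h1 h2 h3 : X -> R) (K : R)
    (Phi : R -> R -> R -> R) :
  measurable D -> 0 <= K ->
  measurable_fun D h1 -> measurable_fun D h2 -> measurable_fun D h3 ->
  (forall a b c a' b' c', `|Phi a b c - Phi a' b' c'| <=
     K * (`|a - a'| + `|b - b'| + `|c - c'|)) ->
  measurable_fun D (fun x => Phi (h1 x) (h2 x) (h3 x)).
Proof.
move=> mD K0 m1 m2 m3 HPhi.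
apply: (measurability (@RGenInftyO.G R)); first exact: RGenInftyO.measurableE.
move=> _ [_ [r ->] <-].
pose E (q : rat * rat * rat) (x : X) : R :=
  Phi (ratr q.1.1) (ratr q.1.2) (ratr q.2) +
  K * (`|h1 x - ratr q.1.1| + `|h2 x - ratr q.1.2| + `|h3 x - ratr q.2|).
rewrite (_ : _ `&` _ = \bigcup_q (D `&` (E q) @^-1` `]-oo, r[)); last first.
  apply/seteqP; split=> [x [Dx /=]|x [q _ [Dx /=]]]; rewrite !in_itv/=.
    (* Three coordinates within [e] put [E q x] within [6 K e] of the value of [Phi]; the summand 1
       makes this smaller than the gap to [r] and covers [K = 0]. *)
    move=> Phir; pose e := (r - Phi (h1 x) (h2 x) (h3 x)) / (6 * K + 1).
    have e0 : 0 < e by rewrite divr_gt0 ?subr_gt0// ltr_wpDl ?mulr_ge0.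
    have approx (a : R) : exists q : rat, `|a - ratr q| <= e.
      have ae : a < a + e by rewrite ltrDl.
      have [q] := rat_in_itvoo ae; rewrite in_itv/= => /andP[aq qe].
      by exists q; rewrite ltr0_norm; lra.
    have [q1 Hq1] := approx (h1 x); have [q2 Hq2] := approx (h2 x).
    have [q3 Hq3] := approx (h3 x).
    exists (q1, q2, q3) => //; split => //=; rewrite in_itv/= /E/=.
    have := HPhi (ratr q1) (ratr q2) (ratr q3) (h1 x) (h2 x) (h3 x).
    rewrite (distrC _ (h1 x)) (distrC _ (h2 x)) (distrC _ (h3 x)).
    set S := _ + _ + _; rewrite ler_norml => /andP[_].
    have S3 : S <= 3 * e by rewrite /S; lra.
    have KS : K * S <= K * (3 * e) by exact: ler_wpM2l.
    have eE : e * (6 * K + 1) = r - Phi (h1 x) (h2 x) (h3 x).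
      by rewrite /e divfK// gt_eqF// ltr_wpDl ?mulr_ge0.
    move: KS eE e0; move: (Phi (h1 x) _ _) (Phi (ratr q1) _ _) => P1 P2.
    by clear; nra.
  rewrite /E => Er; split => //; apply: le_lt_trans Er.
  have := HPhi (h1 x) (h2 x) (h3 x) (ratr q.1.1) (ratr q.1.2) (ratr q.2).
  by rewrite ler_norml => /andP[_]; rewrite lerBlDl.
apply: countable_bigcupT_measurable => // q.
have mE : measurable_fun D (E q).
  apply: measurable_funD => //; apply: measurable_funM => //.
  by do !apply: measurable_funD => //; apply: measurable_fun_norm; apply: measurable_funB.
by apply: mE => //; exact: measurable_itv.
Qed.

Lemma integrableM_ae_bounded (D : set X) (h p : X -> R) (C : R) : measurable D ->
  measurable_fun D h -> nu.-integrable D (EFin \o p) -> 0 <= C ->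
  {ae nu, forall x, D x -> `|h x| <= C} ->
  nu.-integrable D (EFin \o (fun x => h x * p x)).
Proof.
move=> mD mh pint C0 hC.
have mp : measurable_fun D p by exact/measurable_EFinP/(measurable_int nu).
pose h' x := Num.max (- C) (Num.min (h x) C).
have mh' : measurable_fun D h' by apply: measurable_maxr => //; apply: measurable_minr.
have h'C x : `|h' x| <= C.
  by rewrite ler_norml /h' le_max lexx/= ge_max ge_min lexx orbT andbT; lra.
apply: (@ae_eq_integrable _ _ _ nu D (fun x => h' x * p x)) => //.
- apply: (@le_integrable_norm _ _ _ nu D _ (fun x => C * `|p x|)) => //.
  + exact: measurable_funM.
  + have := integrableZl mD C (integrable_abse pint).
    by apply: eq_integrable => // x _.
  + by move=> x _; rewrite normrM ler_wpM2r.
- exact: measurable_funM.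
- apply: ae_imply hC => x H Dx; have := H Dx; rewrite ler_norml => /andP[h1 h2].
  by rewrite /h' min_l// max_r.
Qed.

Lemma Lnorm2_indic (A : set X) : measurable A ->
  ('N[nu]_2%:E[EFin \o (\1_A : X -> R)%R] = nu A `^ 2^-1)%E.
Proof.
move=> mA; rewrite unlock /Lnorm; congr (_ `^ _)%E.
rewrite -[A in RHS]setIT -integral_indic//; apply: eq_integral => x _ /=.
by rewrite indicE; case: (x \in A); rewrite /= ?normr1 ?powR1// normr0 powR0.
Qed.

End BoundedFactors.

(** * From the L^2 norm of the input to its L^1 norm *)

Section HolderBound.
Context {R : realType}.
Notation mu := (@lebesgue_measure R).
Notation lam := (leb1 R).
Notation LR := (caratheodory_type (@wlength R idfun)^*%mu).
Variable T : R.
Hypothesis T0 : 0 < T.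

Notation I0T := (`]0, T[%classic : set R).

Lemma L2B (u1 u2 : R -> R) : L2 T u1 -> L2 T u2 -> L2 T (u1 \- u2).
Proof.
move=> /L2P[m1 i1] /L2P[m2 i2]; apply/L2P.
have E : ((u1 \- u2) \_ I0T) = fun x => (u1 \_ I0T) x - (u2 \_ I0T) x.
  apply/funext => x; have [xT|xT] := pselect (0 < x < T); first by rewrite !patchI.
  by rewrite !patchO// subrr.
have m : measurable_fun (T := LR) setT ((u1 \- u2) \_ I0T).
  by rewrite E; exact: measurable_funB.
split => //; apply: (@integr_le _ _ (fun x => 2 * (u1 \_ I0T) x ^+ 2 + 2 * (u2 \_ I0T) x ^+ 2)).
- exact: measurable_funX.
- by apply: integrD; exact: integrZ.
- move=> x; rewrite E; move: (_ x) => a; move: (_ x) => b.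
  rewrite ger0_norm ?sqr_ge0// -subr_ge0.
  have -> : 2 * a ^+ 2 + 2 * b ^+ 2 - (a - b) ^+ 2 = (a + b) ^+ 2 by ring.
  exact: sqr_ge0.
Qed.

(** Hoelder against the indicator of []0, T[] gives the factor [sqrt T]; the exponential arises from
    [T <= 1 + T <= expR T]. *)
Lemma L2norm_bound (v : R -> R) : L2 T v ->
  exists2 L : R, L2norm T v = L%:E & 0 <= L /\
    prim (fun x => `|(v \_ I0T) x|) T - prim (fun x => `|(v \_ I0T) x|) 0 <=
      expR (T / 2) * L.
Proof.
move=> vL2; have /L2P[mv _] := vL2; have vi := L2_integr vL2.
have Nfin : (L2norm T v < +oo)%E.
  by move: vL2; rewrite /L2 /= inE => /andP[_]; rewrite inE.
have N0 : (0 <= L2norm T v)%E by exact: Lnorm_ge0.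
have NE : L2norm T v = (fine (L2norm T v))%:E by rewrite fineK// ge0_fin_numE.
exists (fine (L2norm T v)) => //; split; first exact: fine_ge0.
have mI : measurable (I0T : set LR) by exact: leb1_measurable_itv.
have m1 : measurable_fun (T := LR) setT (\1_I0T : LR -> R) by exact: measurable_indic.
have half : 2^-1 + 2^-1 = 1 :> R by field.
have := @hoelder _ LR R lam (v \_ I0T) (\1_I0T : LR -> R) 2 2 mv m1 (ltr0n _ 2) (ltr0n _ 2) half.
rewrite Lnorm1 Lnorm2_indic//.
have muE : mu I0T = T%:E.
  by rewrite lebesgue_measure_itv/= lte_fin T0 -EFinD; congr EFin; ring.
move=> H.
have {}H : (\int[lam]_x `|(EFin \o ((v \_ I0T) \* (\1_I0T : LR -> R))%R) x| <=
    L2norm T v * T%:E `^ 2^-1)%E by rewrite -muE; exact: H.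
rewrite NE poweR_EFin -EFinM in H.
rewrite prim_sub ?(ltW T0)//; last exact: integr_norm.
have vE : (v \_ I0T) \* (\1_I0T : LR -> R) = v \_ I0T.
  apply/funext => x /=; rewrite indicE; have [xT|xT] := pselect (0 < x < T).
    by rewrite mem_set// mulr1.
  by rewrite patchO// mul0r.
rewrite vE in H.
have ni := integr_norm vi.
have le1 : ((\int[lam]_(x in `]0, T]) `|(v \_ I0T) x|)%:E <= (fine (L2norm T v) * T `^ 2^-1)%:E)%E.
  apply: le_trans H.
  rewrite [leLHS](fineK (integrable_fin_num (leb1_measurable_itv _) (integr_itv _ ni))).
  apply: ge0_subset_integral.
  - exact: leb1_measurable_itv.
  - exact: measurableT.
  - by apply/measurable_EFinP; exact: integr_meas.
  - by move=> x _; rewrite lee_fin.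
  - by [].
rewrite lee_fin in le1; apply: le_trans le1 _; rewrite mulrC.
apply: ler_wpM2r; first exact: fine_ge0.
rewrite (powR12_sqrt (ltW T0)).
have -> : expR (T / 2) = Num.sqrt (expR T).
  rewrite [in RHS](_ : T = T / 2 + T / 2); last by field.
  by rewrite expRD -expr2 sqrtr_sqr gtr0_norm// expR_gt0.
by rewrite ler_sqrt ?expR_gt0//; have := expR_ge1Dx T; lra.
Qed.

End HolderBound.

(** * The dynamic Preisach operator *)

Section PreisachOperator.
Context {R : realType}.
Notation lam := (leb1 R).
Notation lam2 := (leb2 R).
Notation LR := (caratheodory_type (@wlength R idfun)^*%mu).
Variables (T k rho0 : R) (p : R * R -> R).
Hypotheses (T0 : 0 < T) (k0 : 0 < k).
Hypothesis p_int : lam2.-integrable (triangle rho0) (EFin \o p).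
Hypothesis p_gt0 : {ae lam2, forall rho, triangle rho0 rho -> 0 < p rho}.
Implicit Types (u : R -> R) (xi : R * R -> R).

Notation I0T := (`]0, T[%classic : set R).

Lemma borel_plane_measurable (A : set (measurableTypeR R * measurableTypeR R)) :
  measurable A -> measurable (A : set (plane R)).
Proof. exact: caratheodory_measurable_mu_ext. Qed.

Lemma measurable_plane_fst : measurable_fun (T := plane R) setT (fst : plane R -> R).
Proof.
move=> _ B mB; rewrite setTI; apply: borel_plane_measurable.
by rewrite -[X in measurable X]setTI; apply: measurable_fst.
Qed.

Lemma measurable_plane_snd : measurable_fun (T := plane R) setT (snd : plane R -> R).
Proof.
move=> _ B mB; rewrite setTI; apply: borel_plane_measurable.
by rewrite -[X in measurable X]setTI; apply: measurable_snd.
Qed.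

Lemma measurable_triangle : measurable (triangle rho0 : set (plane R)).
Proof.
have m1 := measurable_plane_fst; have m2 := measurable_plane_snd.
have m12 : measurable_fun (T := plane R) setT (fun rho : plane R => rho.2 - rho.1 : R).
  exact: measurable_funB.
have -> : triangle rho0 = (setT `&` (fst : plane R -> R) @^-1` `[- rho0, +oo[) `&`
   (setT `&` (fun rho : plane R => rho.2 - rho.1 : R) @^-1` `[0, +oo[) `&`
   (setT `&` (snd : plane R -> R) @^-1` `]-oo, rho0]).
  apply/seteqP; split => rho /=; rewrite !in_itv/= !andbT subr_ge0.
    by move=> /and3P[-> -> ->].
  by move=> [[[_ h1] [_ h2]] [_ h3]]; rewrite /triangle /= h1 h2.
apply: measurableI; first apply: measurableI.
- by apply: m1 => //; exact: measurable_itv.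
- by apply: m12 => //; exact: measurable_itv.
- by apply: m2 => //; exact: measurable_itv.
Qed.

(** [eta] drops to the zero function when the initial state leaves [[-1, 1]], so it need not be
    Lipschitz in that state. With the state clamped, [Phi] is Lipschitz on all of R^3; the indicator
    of [[-1, 1]] then restores [eta]. *)
Lemma measurable_eta u xi t : L2 T u -> 0 <= t <= T ->
  measurable_fun (T := plane R) (triangle rho0) xi ->
  measurable_fun (T := plane R) (triangle rho0) (fun rho => eta T k rho u (xi rho) t).
Proof.
(* The projection onto [[-1, 1]], written with positive parts so that [pos_part_lip] applies
   twice. *)
move=> uL2 tT mxi; pose clamp (c : R) := Num.max (2 - Num.max (1 - c) 0) 0 - 1.
have clampI c : -1 <= clamp c <= 1.
  rewrite /clamp; case: (leP (1 - c) 0) => h1;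
    [case: (leP (2 - 0) 0) => h2|case: (leP (2 - (1 - c)) 0) => h2]; apply/andP; split; lra.
have clamp_id c : -1 <= c <= 1 -> clamp c = c.
  move=> /andP[c1 c2]; rewrite /clamp.
  by case: (leP (1 - c) 0) => h1;
    [case: (leP (2 - 0) 0) => h2|case: (leP (2 - (1 - c)) 0) => h2]; lra.
have clamp_lip a b : `|clamp a - clamp b| <= `|a - b|.
  pose A c : R := 2 - Num.max (1 - c) 0.
  have -> : clamp a - clamp b = Num.max (A a) 0 - Num.max (A b) 0 by rewrite /clamp /A; ring.
  apply: le_trans (pos_part_lip _ _) _.
  have -> : A a - A b = Num.max (1 - b) 0 - Num.max (1 - a) 0 by rewrite /A; ring.
  apply: le_trans (pos_part_lip _ _) _.
  by rewrite le_eqVlt; apply/orP; left; apply/eqP; congr `|_|; ring.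
pose Phi a b c := eta T k (a, b) u (clamp c) t.
(* Any bound on the primitive of the indicator of []0, T[] serves: it only enters the Lipschitz
   constant of [Phi]. *)
have [C HC] := prim_bounded (integr_indic 0 T false true).
have C0 : 0 <= C by apply: le_trans (HC 0).
have HPhi a b c a' b' c' : `|Phi a b c - Phi a' b' c'| <=
    (1 + 2 * C * k) * (`|a - a'| + `|b - b'| + `|c - c'|).
  pose L := k * (`|a - a'| + `|b - b'|).
  have L0 : 0 <= L by rewrite mulr_ge0 ?(ltW k0)// addr_ge0.
  have Gi : integr (fun r => L * (\1_I0T : R -> R) r) by exact/integrZ/integr_indic.
  have G0 r : 0 <= L * (\1_I0T : R -> R) r by rewrite mulr_ge0// indicE.
  have HG : {ae lam, forall r, 0 < r < T ->
      `|g k (a, b) (u r) - g k (a', b') (u r)| <= L * (\1_I0T : R -> R) r}.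
    apply: ae_borel_leb1; apply: aeW => /= r rT; rewrite indicE mem_set// mulr1.
    exact: g_lip_rho.
  have := eta_lip T0 k0 uL2 uL2 (clampI c) (clampI c') Gi G0 HG tT.
  rewrite -/(Phi a b c) -/(Phi a' b' c') => /le_trans; apply.
  rewrite !primZ; try exact: integr_indic.
  have cl := clamp_lip c c'; have := HC t; have := HC 0; rewrite !ler_norml.
  move: (prim _ t) (prim _ 0) => P Q /andP[q1 q2] /andP[p1 p2].
  have : L * (P - Q) <= L * (2 * C) by apply: ler_wpM2l => //; lra.
  rewrite mulrBr {3}/L => LPQ.
  have h1 := normr_ge0 (a - a'); have h2 := normr_ge0 (b - b').
  have h3 := normr_ge0 (c - c').
  have : 0 <= 2 * C * k * `|c - c'| by rewrite !mulr_ge0// ltW.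
  move: LPQ cl h1 h2 h3; clear -C0.
  move: (`|a - a'|) (`|b - b'|) (`|c - c'|) (`|clamp c - _|) => v1 v2 v3 v4; lra.
have mtri := measurable_triangle.
have K0 : 0 <= 1 + 2 * C * k by rewrite addr_ge0// !mulr_ge0// ltW.
have mPhi := lipschitz3_measurable mtri K0
  (measurable_funTS measurable_plane_fst) (measurable_funTS measurable_plane_snd) mxi HPhi.
rewrite (_ : (fun rho => _) =
  fun rho : plane R => Phi rho.1 rho.2 (xi rho) * (\1_`[-1, 1]%classic : R -> R) (xi rho)).
  apply: measurable_funM; first exact: mPhi.
  have m1 : measurable_fun (setT : set R) (\1_`[-1, 1]%classic : R -> R).
    by apply: measurable_indic; exact: measurable_itv.
  exact: (measurableT_comp m1 mxi).
apply/funext => rho; rewrite indicE /Phi -surjective_pairing.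
have [c1|c1] := pselect (-1 <= xi rho <= 1).
  by rewrite clamp_id// mem_set ?mulr1//= in_itv.
by rewrite memNset/= ?in_itv// mulr0 eta_out.
Qed.

Lemma eta_integrable u xi t : L2 T u -> 0 <= t <= T -> Y rho0 p xi ->
  lam2.-integrable (triangle rho0) (EFin \o (fun rho => eta T k rho u (xi rho) t * p rho)).
Proof.
move=> uL2 tT [[mxi _] _]; have me := measurable_eta uL2 tT mxi.
have eC : {ae lam2, forall rho, triangle rho0 rho -> `|eta T k rho u (xi rho) t| <= 1}.
  by apply: aeW => rho _; exact: eta_bound.
exact: (integrableM_ae_bounded measurable_triangle me p_int ler01 eC).
Qed.

Lemma F_D_bound u xi t : L2 T u -> 0 <= t <= T -> Y rho0 p xi ->
  `|F_D T k rho0 p u xi t| <= \int[lam2]_(rho in triangle rho0) p rho.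
Proof.
move=> uL2 tT HY; have ei := eta_integrable uL2 tT HY.
apply: le_trans (le_normr_Rintegral measurable_triangle ei) _.
apply: (ae_le_Rintegral measurable_triangle _ p_int).
  by have := integrable_abse ei; apply: eq_integrable => //; exact: measurable_triangle.
apply: ae_imply p_gt0 => rho H trho; have p0 := H trho.
by rewrite normrM (gtr0_norm p0) ler_piMl ?(ltW p0)// eta_bound.
Qed.

Lemma F_D_mono u1 u2 xi1 xi2 t : L2 T u1 -> L2 T u2 -> Y rho0 p xi1 -> Y rho0 p xi2 ->
  {ae lam, forall t, 0 < t < T -> u1 t <= u2 t} ->
  {ae lam2, forall rho, triangle rho0 rho -> xi1 rho <= xi2 rho} ->
  0 <= t <= T -> F_D T k rho0 p u1 xi1 t <= F_D T k rho0 p u2 xi2 t.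
Proof.
move=> u1L2 u2L2 Y1 Y2 u12 xi12 tT.
apply: (ae_le_Rintegral measurable_triangle); [exact: eta_integrable|exact: eta_integrable|].
have H12 := ae_imply2 (fun _ a b => conj a b) Y1.2 Y2.2.
have H34 := ae_imply2 (fun _ a b => conj a b) xi12 p_gt0.
apply: ae_imply2 H12 H34 => rho [h1 h2] [h3 h4] trho.
apply: ler_wpM2r; first exact/ltW/h4.
have x1 : -1 <= xi1 rho <= 1 by rewrite -ler_norml; exact: h1.
have x2 : -1 <= xi2 rho <= 1 by rewrite -ler_norml; exact: h2.
(* The zero forcing bound is written as a multiple of the indicator, whose integrability is known;
   it is admissible because [g] is nondecreasing in the input. *)
have G0i : integr (fun r : LR => 0 * (\1_I0T : R -> R) r) by exact/integrZ/integr_indic.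
have G0 r : 0 <= 0 * (\1_I0T : R -> R) r by rewrite mul0r.
have HG : {ae lam, forall r, 0 < r < T ->
    g k rho (u1 r) - g k rho (u2 r) <= 0 * (\1_I0T : R -> R) r}.
  by apply: ae_imply u12 => r H rT; rewrite mul0r subr_le0 g_mono//; exact: H.
have := relay_compare T0 (etaP T0 k0 rho u1L2 x1) (etaP T0 k0 rho u2L2 x2) G0i G0 HG tT.
rewrite !primZ ?mul0r ?subrr ?addr0; try exact: integr_indic.
by rewrite max_r ?subr_le0//; exact: h3.
Qed.

Lemma xi_dist_integrable xi1 xi2 : Y rho0 p xi1 -> Y rho0 p xi2 ->
  lam2.-integrable (triangle rho0) (EFin \o (fun rho => `|xi1 rho - xi2 rho| * p rho)).
Proof.
move=> [[m1 _] h1] [[m2 _] h2].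
have mh := measurable_fun_norm (measurable_funB m1 m2).
have hC : {ae lam2, forall rho, triangle rho0 rho -> `|(`|xi1 rho - xi2 rho|)| <= 2}.
  apply: ae_imply2 h1 h2 => rho H1 H2 trho; rewrite normr_id.
  by apply: le_trans (ler_normB _ _) _; exact: (lerD (H1 trho) (H2 trho)).
exact: (integrableM_ae_bounded measurable_triangle mh p_int (ler0n _ 2) hC).
Qed.

(** [G] bounds the forcing differences for all [rho] of the triangle at once, so its increment
    leaves the integral and only the mass of [p] remains. *)
Lemma F_D_dist u1 u2 xi1 xi2 t (G : R -> R) :
  L2 T u1 -> L2 T u2 -> Y rho0 p xi1 -> Y rho0 p xi2 ->
  integr G -> (forall r, 0 <= G r) ->
  (forall r rho, 0 < r < T -> triangle rho0 rho ->
     `|g k rho (u1 r) - g k rho (u2 r)| <= G r) ->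
  0 <= t <= T ->
  `|F_D T k rho0 p u1 xi1 t - F_D T k rho0 p u2 xi2 t| <=
    \int[lam2]_(rho in triangle rho0) (`|xi1 rho - xi2 rho| * p rho) +
    (prim G t - prim G 0) * \int[lam2]_(rho in triangle rho0) p rho.
Proof.
move=> u1L2 u2L2 Y1 Y2 Gi G0 HG tT.
have e1 := eta_integrable u1L2 tT Y1; have e2 := eta_integrable u2L2 tT Y2.
have mtri := measurable_triangle.
have xid := xi_dist_integrable Y1 Y2.
have pN : lam2.-integrable (triangle rho0) (EFin \o (fun rho => (prim G t - prim G 0) * p rho)).
  by have := integrableZl mtri (prim G t - prim G 0) p_int; exact: eq_integrable.
rewrite -RintegralB// -(RintegralZl _ mtri p_int) -RintegralD//.
have ed : lam2.-integrable (triangle rho0) (EFin \o (fun rho =>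
    eta T k rho u1 (xi1 rho) t * p rho - eta T k rho u2 (xi2 rho) t * p rho)).
  by have := integrableB mtri e1 e2; exact: eq_integrable.
apply: le_trans (le_normr_Rintegral mtri ed) _.
apply: (ae_le_Rintegral mtri).
- by have := integrable_abse ed; exact: eq_integrable.
- by have := integrableD mtri xid pN; exact: eq_integrable.
have H12 := ae_imply2 (fun _ a b => conj a b) Y1.2 Y2.2.
apply: ae_imply2 H12 p_gt0 => rho [h1 h2] h4 trho.
have p0 := h4 trho.
rewrite -mulrBl -mulrDl normrM (gtr0_norm p0) ler_pM2r//.
have x1 : -1 <= xi1 rho <= 1 by rewrite -ler_norml; exact: h1.
have x2 : -1 <= xi2 rho <= 1 by rewrite -ler_norml; exact: h2.
apply: (eta_lip T0 k0 u1L2 u2L2 x1 x2 Gi G0 _ tT).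
by apply: ae_borel_leb1; apply: aeW => /= r rT; exact: HG.
Qed.

Lemma F_D_time u xi (M : R -> R) s t : L2 T u -> Y rho0 p xi -> integr M ->
  (forall r rho, 0 < r < T -> triangle rho0 rho -> 2 * `|g k rho (u r)| <= M r) ->
  (forall r, 0 <= M r) -> 0 <= s -> s <= t -> t <= T ->
  `|F_D T k rho0 p u xi t - F_D T k rho0 p u xi s| <=
    (prim M t - prim M s) * \int[lam2]_(rho in triangle rho0) p rho.
Proof.
move=> uL2 HY Mi HM M0 s0 st tT.
have tI : 0 <= t <= T by rewrite tT andbT (le_trans s0).
have sI : 0 <= s <= T by rewrite s0 (le_trans st).
have e1 := eta_integrable uL2 tI HY; have e2 := eta_integrable uL2 sI HY.
have mtri := measurable_triangle.
rewrite -RintegralB// -(RintegralZl _ mtri p_int).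
have ed : lam2.-integrable (triangle rho0) (EFin \o (fun rho =>
    eta T k rho u (xi rho) t * p rho - eta T k rho u (xi rho) s * p rho)).
  by have := integrableB mtri e1 e2; exact: eq_integrable.
apply: le_trans (le_normr_Rintegral mtri ed) _.
apply: (ae_le_Rintegral mtri).
- by have := integrable_abse ed; exact: eq_integrable.
- by have := integrableZl mtri (prim M t - prim M s) p_int; exact: eq_integrable.
apply: ae_imply p_gt0 => rho h4 trho; have p0 := h4 trho.
rewrite -mulrBl normrM (gtr0_norm p0) ler_pM2r//.
by apply: (eta_time T0 k0) => // r rT; exact: HM.
Qed.

End PreisachOperator.

Lemma ae_ge0_Rintegral d (X : measurableType d) (R : realType)
    (nu : {measure set X -> \bar R}) (D : set X) (f : X -> R) :
  measurable D -> nu.-integrable D (EFin \o f) ->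
  {ae nu, forall x, D x -> 0 <= f x} -> 0 <= \int[nu]_(x in D) f x.
Proof.
move=> mD fi f0; have -> : 0 = \int[nu]_(x in D) (fun=> 0) x :> R.
  by rewrite /Rintegral integral0.
by apply: ae_le_Rintegral => //; exact: integrable0.
Qed.

(** * Time regularity and Lipschitz estimate of the operator *)

Section PreisachH1.
Context {R : realType}.
Notation lam := (leb1 R).
Notation lam2 := (leb2 R).
Notation LR := (caratheodory_type (@wlength R idfun)^*%mu).
Variables (T k rho0 : R) (p : R * R -> R).
Hypotheses (T0 : 0 < T) (k0 : 0 < k).
Hypothesis rho0_gt0 : 0 < rho0.
Hypothesis p_int : lam2.-integrable (triangle rho0) (EFin \o p).
Hypothesis p_gt0 : {ae lam2, forall rho, triangle rho0 rho -> 0 < p rho}.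
Implicit Types (u : R -> R) (xi : R * R -> R).

Notation I0T := (`]0, T[%classic : set R).
Notation P := (\int[lam2]_(rho in triangle rho0) p rho).

Lemma p_mass_ge0 : 0 <= P.
Proof.
apply: (ae_ge0_Rintegral (@measurable_triangle R rho0) p_int).
by apply: ae_imply p_gt0 => rho H trho; exact/ltW/H.
Qed.

Lemma p_massE : (\int[lam2]_(rho in triangle rho0) (p rho)%:E)%E = P%:E.
Proof. by rewrite -[LHS](fineK (integrable_fin_num (@measurable_triangle R rho0) p_int)). Qed.

Lemma L2_affine u a b : L2 T u -> L2 T (fun r => a * `|u r| + b).
Proof.
move=> /L2P[mu_ u2]; apply/L2P.
have E : (fun r => a * `|u r| + b) \_ I0T =
    fun r => a * `|(u \_ I0T) r| + b * (\1_I0T : R -> R) r.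
  apply/funext => r; rewrite indicE; have [rT|rT] := pselect (0 < r < T).
    by rewrite !patchI// mem_set// mulr1.
  by rewrite !patchO// memNset// normr0 !mulr0 addr0.
have m1 : measurable_fun (T := LR) setT (\1_I0T : LR -> R).
  exact: integr_meas (integr_indic _ _ _ _).
have m : measurable_fun (T := LR) setT ((fun r => a * `|u r| + b) \_ I0T).
  have ma := measurable_funM (measurable_cst a) (measurable_fun_norm mu_).
  have mb := measurable_funM (measurable_cst b) m1.
  by rewrite E; exact: (measurable_funD ma mb).
split => //; apply: (@integr_le _ _ (fun r => 2 * a ^+ 2 * (u \_ I0T) r ^+ 2 +
    2 * b ^+ 2 * (\1_I0T : R -> R) r)).
- exact: measurable_funX.
- by apply: integrD; apply: integrZ => //; exact: integr_indic.
- move=> r; rewrite E indicE; have [rT|rT] := pselect (0 < r < T); last first.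
    by rewrite !patchO// memNset// normr0 !mulr0 addr0 !expr0n/= mulr0 addr0 normr0.
  rewrite !patchI// mem_set// !mulr1 ger0_norm ?sqr_ge0//.
  rewrite -(real_normK (num_real (u r))) -subr_ge0.
  rewrite (_ : _ - _ = (a * `|u r| - b) ^+ 2); first exact: sqr_ge0.
  by ring.
Qed.

Lemma F_D_H1 u xi : L2 T u -> Y rho0 p xi -> H1 T (F_D T k rho0 p u xi).
Proof.
move=> uL2 HY; have P0 := p_mass_ge0.
pose F := F_D T k rho0 p u xi.
(* Twice the bound of [g_bound], with both thresholds at most [rho0] in absolute value. *)
pose M0 r := 4 * k * `|u r| + 4 * k * rho0.
have M0L2 : L2 T M0 by exact: L2_affine.
pose M := M0 \_ I0T.
have Mi : integr M by exact: L2_integr.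
have M_ge0 r : 0 <= M r.
  have [rT|rT] := pselect (0 < r < T); last by rewrite /M patchO.
  by rewrite /M patchI// /M0 addr_ge0// !mulr_ge0// ltW.
have gM r rho : 0 < r < T -> triangle rho0 rho -> 2 * `|g k rho (u r)| <= M r.
  move=> rT /and3P[h1 h2 h3]; rewrite /M patchI// /M0.
  have r1 : `|rho.1| <= rho0 by rewrite ler_norml h1 (le_trans h2).
  have r2 : `|rho.2| <= rho0 by rewrite ler_norml h3 (le_trans h1).
  have := g_bound k0 rho (u r).
  have : k * (2 * `|u r| + `|rho.1| + `|rho.2|) <= k * (2 * `|u r| + rho0 + rho0).
    by rewrite ler_pM2l// lerD// lerD2l.
  by move: (`|g _ _ _|) (`|u r|) (_ * (_ + `|rho.2|)) => v1 v2 v3; lra.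
pose c (t : R) := Num.max 0 (Num.min t T).
have cI t : 0 <= c t <= T.
  by rewrite /c le_max lexx/= ge_max (ltW T0) ge_min lexx orbT.
have c_id t : 0 <= t <= T -> c t = t.
  by move=> /andP[t0 tT]; rewrite /c min_l// max_r.
have c_mono s t : s <= t -> c s <= c t.
  move=> st; rewrite /c ge_max le_max lexx/= le_max; apply/orP; right.
  by rewrite le_min !ge_min st lexx orbT.
(* Freezing time outside [[0, T]] does not enlarge the increments of a nondecreasing function, so
   the modulus of [F] extends to the whole line. *)
have clampN (N : R -> R) s t : {homo N : x y / x <= y} -> s <= t ->
    N (c t) - N (c s) <= N t - N s.
  move=> ndN st; have NN := ndN _ _ st.
  have [t0|t0] := leP t 0.
    have z r : r <= 0 -> c r = 0.
      by move=> r0; rewrite /c min_l ?(le_trans r0 (ltW T0))// max_l.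
    by rewrite !z ?(le_trans st)// subrr subr_ge0.
  have [sT|sT] := leP T s.
    have z r : T <= r -> c r = T by move=> r0; rewrite /c min_r// max_r// ltW.
    by rewrite !z ?(le_trans sT)// subrr subr_ge0.
  apply: lerB; apply: ndN.
    by rewrite /c ge_max (ltW t0)/= ge_min lexx.
  by rewrite /c le_max le_min lexx (ltW sT) orbT.
have PMi : integr (fun r => P * M r) by exact: integrZ.
have PM0 r : 0 <= P * M r by rewrite mulr_ge0.
have HF s t : s <= t -> `|F (c t) - F (c s)| <=
    prim (fun r => P * M r) t - prim (fun r => P * M r) s.
  move=> st; have /andP[cs0 _] := cI s; have /andP[_ ctT] := cI t.
  rewrite !primZ// -mulrBr mulrC.
  apply: le_trans (F_D_time T0 k0 p_int p_gt0 uL2 HY Mi gM M_ge0 cs0 (c_mono _ _ st) ctT) _.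
  apply: ler_wpM2r => //; apply: (clampN (prim M)) => //.
  by move=> x y; exact: prim_mono.
have [h [hi hM hE]] := lipschitz_density PM0 PMi HF.
(* The pointwise bound of [lipschitz_density] forces [h] to vanish with [M] outside []0, T[]. *)
have h_supp : h \_ I0T = h.
  apply/funext => r; have [rT|rT] := pselect (0 < r < T); first by rewrite patchI.
  rewrite patchO//; have := hM r; rewrite /M patchO// mulr0 normr_le0.
  by move=> /eqP.
have FE t : 0 <= t <= T -> F t = F 0 - prim h 0 + prim h t.
  move=> tT; have /andP[t0 _] := tT; have := hE 0 t t0.
  rewrite !c_id//; last by rewrite lexx ltW.
  by move=> E; rewrite addrAC -addrA -E addrCA subrr addr0.
have cont : continuous (fun t => F 0 - prim h 0 + prim h t).
  by move=> t; apply: cvgD; [exact: cvg_cst|exact: prim_continuous].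
have hL2 : L2 T h.
  apply: (L2_le M0L2 (C := P)); first by rewrite h_supp; exact: integr_meas.
  move=> r rT; apply: le_trans (hM r) _; rewrite /M patchI//.
  by apply: ler_wpM2l => //; exact: ler_norm.
split.
- apply: (@subspace_eq_continuous _ _ _ (fun t => F 0 - prim h 0 + prim h t)).
    by move=> t; rewrite inE /= in_itv/= => tT; rewrite /= -FE.
  exact: continuous_subspaceT.
- apply: (L2_bounded (C := P)); last first.
    by move=> t /andP[t0 tT]; apply: (F_D_bound T0 k0 p_int p_gt0) => //; rewrite !ltW.
  rewrite (_ : _ \_ _ = fun t => (F 0 - prim h 0 + prim h t) * (\1_I0T : R -> R) t).
    apply: measurable_funM; last exact: integr_meas (integr_indic _ _ _ _).
    exact: measurable_leb1_continuous.
  apply/funext => t; rewrite indicE; have [tT|tT] := pselect (0 < t < T).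
    rewrite patchI// mem_set// mulr1 -FE//.
    by case/andP: tT => *; rewrite !ltW.
  by rewrite patchO// memNset// mulr0.
- exists h; apply: (weak_derivative_prim T0 hL2 (al := F 0 - prim h 0)) => t /andP[t0 tT].
  by rewrite h_supp -FE// !ltW.
Qed.

Lemma F_D_lipschitz u1 u2 xi1 xi2 :
  L2 T u1 -> L2 T u2 -> Y rho0 p xi1 -> Y rho0 p xi2 ->
  (Cnorm T (F_D T k rho0 p u1 xi1 \- F_D T k rho0 p u2 xi2)%R <=
   (expR (T / 2)%R)%:E *
     (L1pnorm rho0 p (xi1 \- xi2)%R +
      k%:E * L2norm T (u1 \- u2)%R *
        \int[leb2 R]_(rho in triangle rho0) (p rho)%:E))%E.
Proof.
move=> u1L2 u2L2 Y1 Y2; have P0 := p_mass_ge0.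
have vL2 := L2B u1L2 u2L2; have vi := L2_integr vL2.
have [L LE [L0 HL]] := L2norm_bound T0 vL2.
have mtri := @measurable_triangle R rho0.
have xid := xi_dist_integrable p_int Y1 Y2.
pose X := \int[lam2]_(rho in triangle rho0) (`|xi1 rho - xi2 rho| * p rho).
have XE : L1pnorm rho0 p (xi1 \- xi2) = X%:E.
  by rewrite /X -[LHS](fineK (integrable_fin_num mtri xid)).
have X0 : 0 <= X.
  apply: (ae_ge0_Rintegral mtri xid); apply: ae_imply p_gt0 => rho H trho.
  by rewrite mulr_ge0//; exact/ltW/H.
have -> : ((expR (T / 2)%R)%:E * (L1pnorm rho0 p (xi1 \- xi2)%R +
    k%:E * L2norm T (u1 \- u2)%R * \int[lam2]_(rho in triangle rho0) (p rho)%:E) =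
    (expR (T / 2) * (X + k * L * P))%:E)%E.
  by rewrite LE XE p_massE.
apply: ge_ereal_sup => _ [t /= tI <-]; rewrite in_itv/= in tI.
rewrite lee_fin.
have nvi : integr (fun r => `|((u1 \- u2) \_ I0T) r|) by exact: integr_norm.
pose G r := k * `|((u1 \- u2) \_ I0T) r|.
have Gi : integr G by exact: integrZ.
have G0 r : 0 <= G r by rewrite mulr_ge0// ltW.
have HG r rho : 0 < r < T -> triangle rho0 rho ->
    `|g k rho (u1 r) - g k rho (u2 r)| <= G r.
  by move=> rT /and3P[_ h _]; rewrite /G patchI//; exact: g_lip.
apply: le_trans (F_D_dist T0 k0 p_int p_gt0 u1L2 u2L2 Y1 Y2 Gi G0 HG tI) _.
rewrite -/X.
(* Only the input term produces the exponential; being at least 1, it can also be put in front of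
   the distance of the initial states. *)
have e1 : 1 <= expR (T / 2).
  by apply: le_trans (expR_ge1Dx _); rewrite lerDl divr_ge0// ltW.
have GT : prim G t - prim G 0 <= k * (expR (T / 2) * L).
  have /andP[_ tT] := tI.
  have : prim G t <= prim G T by exact: prim_mono.
  move=> h; apply: (@le_trans _ _ (prim G T - prim G 0)); first by rewrite lerD2r.
  by rewrite !primZ// -mulrBr ler_pM2l.
rewrite mulrDr; apply: lerD; first by rewrite ler_peMl.
rewrite !mulrA; apply: ler_wpM2r => //.
by apply: le_trans GT _; rewrite mulrA (mulrC k).
Qed.

End PreisachH1.

Theorem lemma3p1 (R : realType) (T k rho0 : R) (p : R * R -> R)
    (T_gt0 : 0 < T) (k_gt0 : 0 < k) (rho0_gt0 : 0 < rho0)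
    (p_L1 : (leb2 R).-integrable (triangle rho0) (EFin \o p))
    (p_gt0 : {ae leb2 R, forall rho, triangle rho0 rho -> 0 < p rho}) :
  [/\ forall u xi, L2 T u -> Y rho0 p xi -> H1 T (F_D T k rho0 p u xi),
      forall u1 u2 xi1 xi2,
        L2 T u1 -> L2 T u2 -> Y rho0 p xi1 -> Y rho0 p xi2 ->
        {ae leb1 R, forall t, t \in `[0, T] -> u1 t <= u2 t} ->
        {ae leb2 R, forall rho, triangle rho0 rho -> xi1 rho <= xi2 rho} ->
        forall t, t \in `[0, T] ->
          F_D T k rho0 p u1 xi1 t <= F_D T k rho0 p u2 xi2 t,
      forall u1 u2 xi1 xi2,
        L2 T u1 -> L2 T u2 -> Y rho0 p xi1 -> Y rho0 p xi2 ->
        (Cnorm T (F_D T k rho0 p u1 xi1 \- F_D T k rho0 p u2 xi2)%R <=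
         (expR (T / 2)%R)%:E *
           (L1pnorm rho0 p (xi1 \- xi2)%R +
            k%:E * L2norm T (u1 \- u2)%R *
              \int[leb2 R]_(rho in triangle rho0) (p rho)%:E))%E
    & forall v xi, L2 T v -> Y rho0 p xi ->
        (Cnorm T (F_D T k rho0 p v xi) <=
         \int[leb2 R]_(rho in triangle rho0) (p rho)%:E)%E].
Proof.
split.
- by move=> u xi; exact: F_D_H1.
- move=> u1 u2 xi1 xi2 u1L2 u2L2 Y1 Y2 u12 xi12 t; rewrite in_itv/= => tI.
  apply: F_D_mono => //; apply: ae_imply u12 => r H /andP[r0 rT].
  by apply: H; rewrite in_itv/= !ltW.
- by move=> u1 u2 xi1 xi2; exact: F_D_lipschitz.
- move=> v xi vL2 HY; rewrite (p_massE p_L1).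
  apply: ge_ereal_sup => _ [t /= tI <-]; rewrite in_itv/= in tI.
  by rewrite lee_fin; exact: F_D_bound.
Qed.
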